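(* Let $X=\langle a,b,c\rangle\cong X_1(1+n)$, $n\ge3$ odd, be a $3$-generated $C_2$-axet, where $a$ is the fixed axis. Let $Y=\langle a,b\rangle=\{a,b\}$ and $Z=X-\{a\}$. Suppose that $\Theta$ is a shape on $X$ for $\mathcal M(\alpha,\beta)$ and $A$ is a completion (with $X$ identified with its image in $A$ and $A_Y=\langle\!\langle a,b\rangle\!\rangle$). Let $\sigma_a$ be the automorphism of $A$ acting as $-1$ on $A_\alpha(a)$ and as $1$ on $A_1(a)\oplus A_0(a)$; for $z\in Z$ put $z'=z^{\sigma_a}$, and $Z'=\{z':z\in Z\}$. (1) If $\sigma_a=1$, then $A_Y\cong2\mathrm B$ and $A\cong1\mathrm A\oplus\langle\!\langle b,c\rangle\!\rangle$, where $\langle\!\langle b,c\rangle\!\rangle$ is symmetric. (2) If $\sigma_a\ne1$, then $A_Y\in\mathcal J^2(\alpha)-\{2\mathrm B\}$ and $A$ contains an axet $\{a\}\cup Z\cup Z'\cong X_2(1+2n)$ with Miyamoto map $t$ given by $t_a=\sigma_a$ and $t_z=t_{z'}=\tau_z$ for all $z\in Z$. Moreover, $B:=\langle\!\langle b',c\rangle\!\rangle$ is a symmetric $2$-generated subalgebra with $X(B)=Z\cup Z'$ and one of the following holds: (a) $A=B$; or (b) $\alpha=\frac12$, $A_Y\cong S(-2)$ and $\langle\!\langle b,b'\rangle\!\rangle\cong S(2)^\circ$; or (c) $\alpha=\frac12$, $A_Y\cong S(0)$, $b'=b^-$ and $\langle\!\langle b,b'\rangle\!\rangle\cong2\mathrm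 B$.
   Context: **Axial algebras.** $\mathbb F$ is a field of characteristic not $2$; algebras are commutative, not necessarily associative, over $\mathbb F$. $A_\lambda(a)=\{v:av=\lambda v\}$; $\langle\!\langle Y\rangle\!\rangle$ is the subalgebra generated by $Y$. For $1,0,\alpha,\beta$ pairwise distinct, the fusion law $\mathcal M(\alpha,\beta)$ on $\{1,0,\alpha,\beta\}$ is the symmetric operation $1\star1=\{1\}$, $1\star0=\emptyset$, $1\star\alpha=0\star\alpha=\{\alpha\}$, $1\star\beta=0\star\beta=\alpha\star\beta=\{\beta\}$, $0\star0=\{0\}$, $\alpha\star\alpha=\{1,0\}$, $\beta\star\beta=\{1,0,\alpha\}$. The law $\mathcal J(\eta)$ ($\eta\ne0,1$) on $\{1,0,\eta\}$ is $1\star1=\{1\}$, $1\star0=\emptyset$, $0\star0=\{0\}$, $1\star\eta=0\star\eta=\{\eta\}$, $\eta\star\eta=\{1,0\}$. For a law $\mathcal F$, an $\mathcal F$-axis is an idempotent $a$ with $A=\bigoplus_{\lambda\in\mathcal F}A_\lambda(a)$ and $A_\lambda(a)A_\mu(a)\subseteq\bigoplus_{\nu\in\lambda\star\mu}A_\nu(a)$; primitive if $A_1(a)=\mathbb Fa$. An $\mathcal F$-axial algebra is an algebra generated by a set of primitive $\mathcal F$-axes. $\mathcal J^2(\eta)$ is the set of $2$-generated $\mathcal J(\eta)$-axial algebras. The Miyamoto involution $\tau_a$ of an $\mathcal M(\alpha,\beta)$-axis acts as $-1$ on $A_\beta(a)$ and as $1$ on the other eigenspaces. An algebra generated by two axes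 $x,y$ is symmetric if it has an involutory automorphism switching $x$ and $y$; its axet $X(\langle\!\langle x,y\rangle\!\rangle)$ is the union of the orbits of $x$ and $y$ under $\langle\tau_x,\tau_y\rangle$. **Axets.** A $C_2$-axet $(G,X,\tau)$ is a group $G$, a $G$-set $X$ and a (Miyamoto) map $x\mapsto\tau_x\in G_x$ with $\tau_x^2=1$, $\tau_{xg}=g^{-1}\tau_xg$. A subset $Y$ is closed (a subaxet) if invariant under all $\tau_y$, $y\in Y$; $\langle Y\rangle$ is the smallest closed subset containing $Y$. A morphism is a map $\psi$ with $\psi(y\tau_x)=\psi(y)\tau'_{\psi(x)}$; isomorphisms are bijective morphisms. $X(n)$ is $\mathbb Z/n\mathbb Z$ with $G=D_{2n}$ of order $2n$, $\tau_i:j\mapsto2i-j$. $X_1(1+n)=\{a\}\cup X(n)$ with $a$ fixed by $D_{2n}$ and $\tau_a=1$. For $m$ even, $X_2(1+m)=\{a\}\cup X(m)$ with $a$ fixed by $D_{2m}$ and $\tau_a:j\mapsto j+\frac m2$. The axet $X(A)$ of an $\mathcal M(\alpha,\beta)$-axial algebra $A$ is its set of generating axes, closed under the group generated by all $\tau_x$, with $G$ its setwise stabiliser in $\mathrm{Aut}(A)$. **Shapes.** Let $\mathcal X_2$ be the set of subaxets of $X$ generated by one or two axes. A shape on $X$ for $\mathcal M(\alpha,\beta)$ is a family $\Theta=\{\theta_W:W\to X(A_W)\mid W\in\mathcal X_2\}$ of axet isomorphisms, with $A_W$ an $\mathcal M(\alpha,\beta)$-axial algebra, such that whenever $g\in G$,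 $V,W\in\mathcal X_2$, $V^g\subseteq W$, there is an injective algebra homomorphism $\phi:A_V\to A_W$ with $\theta_W(v^g)=\phi(\theta_V(v))$ for $v\in V$. A completion of $\Theta$ is an $\mathcal M(\alpha,\beta)$-axial algebra $A$ with a surjective axet morphism $\psi:X\to X(A)$ such that for each $W\in\mathcal X_2$ there is an algebra homomorphism $\phi_W:A_W\to\langle\!\langle\psi(W)\rangle\!\rangle\subseteq A$ with $\phi_W\circ\theta_W=\psi|_W$. Axes of $X$ are identified with their images in $A$ (so $\psi$ is injective), and $A_W$ with the subalgebra $\langle\!\langle W\rangle\!\rangle$ of $A$. Since $a$ is fixed, $\tau_a=1$ on $A$, so $A_\beta(a)=0$ and $\sigma_a$ is an automorphism. **Algebras.** $1\mathrm A=\mathbb F$. $2\mathrm B$ is spanned by two idempotents with product $0$. $S(\delta)=\mathbb F\mathbf1\oplus V$, where $V$ has basis $u,v$ and symmetric bilinear form with values $(u,u)=(v,v)=2$, $(u,v)=\delta$; $\mathbf1$ is the identity and $ww'=\frac12(w,w')\mathbf1$ for $w,w'\in V$. Its axes are $\frac12(\mathbf1+w)$ with $(w,w)=2$; the opposite of the axis $x=\frac12(\mathbf1+w)$ is $x^-=\frac12(\mathbf1-w)$. $S(2)^\circ$ is the $2$-dimensional algebra with basis $x,y$, $x^2=x$, $y^2=y$, $xy=\frac12(x+y)$. *)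

(* Defs.v *)
From HB Require Import structures.
From mathcomp Require Import all_boot all_order all_algebra.
From mathcomp Require Import ring.
From mathcomp Require Import boolp classical_sets functions.

Set Implicit Arguments.
Unset Strict Implicit.
Unset Printing Implicit Defensive.

Import GRing.Theory.

Local Open Scope classical_set_scope.
Local Open Scope ring_scope.

HB.mixin Record Lmodule_isNAAlg (F : fieldType) A of GRing.Lmodule F A := {
  amul : A -> A -> A;
  amulC : commutative amul;
  amulDl : left_distributive amul +%R;
  amulZl : forall (k : F) (x y : A), amul (k *: x) y = k *: amul x y
}.

#[short(type="naAlgType")]
HB.structure Definition NAAlg (F : fieldType) :=
  {A of GRing.Lmodule F A & Lmodule_isNAAlg F A}.

Notation "x ** y" := (amul x y) (at level 40, left associativity) : ring_scope.

Section NAAlgTheory.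
Variables (F : fieldType) (A : naAlgType F).
Implicit Types (x y : A) (k : F).

Lemma amulDr x : {morph amul x : y z / y + z}.
Proof. by move=> y z /=; rewrite amulC amulDl (amulC y) (amulC z). Qed.

Lemma amulZr k x y : x ** (k *: y) = k *: (x ** y).
Proof. by rewrite amulC amulZl amulC. Qed.

Lemma amul0r x : 0 ** x = 0.
Proof. by have := amulZl 0 0 x; rewrite !scale0r. Qed.

End NAAlgTheory.

Definition alg_hom (F : fieldType) (A B : naAlgType F) (f : A -> B) : Prop :=
  linear f /\ {morph f : x y / x ** y}.

Definition alg_iso (F : fieldType) (A B : naAlgType F) (f : A -> B) : Prop :=
  alg_hom f /\ bijective f.

Definition alg_isomorphic (F : fieldType) (A B : naAlgType F) : Prop :=
  exists f : A -> B, alg_iso f.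

Notation "A ~= B" := (alg_isomorphic A B) (at level 70, no associativity).

Section DirectSum.
Variables (F : fieldType) (A B : naAlgType F).

Definition dsum_mul (x y : A * B) : A * B := (x.1 ** y.1, x.2 ** y.2).

Fact dsum_mulC : commutative dsum_mul.
Proof. by move=> x y; rewrite /dsum_mul amulC [x.2 ** _]amulC. Qed.

Fact dsum_mulDl : left_distributive dsum_mul +%R.
Proof. by move=> x y z; rewrite /dsum_mul /= !amulDl. Qed.

Fact dsum_mulZl (k : F) x y : dsum_mul (k *: x) y = k *: dsum_mul x y.
Proof. by rewrite /dsum_mul /= !amulZl. Qed.

HB.instance Definition _ :=
  Lmodule_isNAAlg.Build F (A * B)%type dsum_mulC dsum_mulDl dsum_mulZl.

End DirectSum.

Section GeneratedSubalgebra.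
Variables (F : fieldType) (A : naAlgType F).

Definition is_subalgebra (S : set A) : Prop :=
  [/\ S 0, (forall k x y, S x -> S y -> S (k *: x + y)) &
      (forall x y, S x -> S y -> S (x ** y))].

Definition gen_set (Y : set A) : set A := smallest is_subalgebra Y.

Lemma gen_set_subalgebra Y : is_subalgebra (gen_set Y).
Proof.
split=> [M [[]] //|k x y Sx Sy M MY|x y Sx Sy M MY].
  by case: (MY) => -[_ + _] _; apply; [apply: Sx|apply: Sy].
by case: (MY) => -[_ _ +] _; apply; [apply: Sx|apply: Sy].
Qed.

Lemma sub_gen_set Y : Y `<=` gen_set Y.
Proof. exact: sub_gen_smallest. Qed.

Definition gen_pred (Y : set A) : {pred A} := fun x => x \in gen_set Y.

Lemma gen_predE Y x : (x \in gen_pred Y) = (x \in gen_set Y).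
Proof. by []. Qed.

Fact gen_pred_submod Y : submod_closed (gen_pred Y).
Proof.
have [S0 SD _] := gen_set_subalgebra Y.
split=> [|k x y]; rewrite !gen_predE; first exact/mem_set.
move=> /set_mem Sx /set_mem Sy; apply/mem_set; exact: SD.
Qed.

HB.instance Definition _ Y :=
  GRing.isSubmodClosed.Build F A (gen_pred Y) (gen_pred_submod Y).

(** [gen_alg Y] is <<Y>> as an algebra in its own right; it coerces to [A]
    through the inclusion [gen_val]. *)
Record gen_alg (Y : set A) := GenAlg
  { gen_val :> A ; gen_valP : gen_val \in gen_pred Y }.

HB.instance Definition _ Y := [isSub for @gen_val Y].
HB.instance Definition _ Y := [Choice of gen_alg Y by <:].
HB.instance Definition _ Y := [SubChoice_isSubLmodule of gen_alg Y by <:].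

Fact gen_mulP Y (x y : gen_alg Y) : gen_val x ** gen_val y \in gen_pred Y.
Proof.
have [_ _ SM] := gen_set_subalgebra Y.
rewrite gen_predE; apply/mem_set.
by apply: SM; apply/set_mem; rewrite -gen_predE; apply: gen_valP.
Qed.

Definition gen_mul Y (x y : gen_alg Y) : gen_alg Y := GenAlg (gen_mulP x y).

Fact gen_mulC Y : commutative (@gen_mul Y).
Proof. by move=> x y; apply/val_inj; rewrite /= amulC. Qed.

Fact gen_mulDl Y : left_distributive (@gen_mul Y) +%R.
Proof. by move=> x y z; apply/val_inj; rewrite /= amulDl. Qed.

Fact gen_mulZl Y (k : F) (x y : gen_alg Y) :
  gen_mul (k *: x) y = k *: gen_mul x y.
Proof. by apply/val_inj; rewrite /= amulZl. Qed.

HB.instance Definition _ Y :=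
  Lmodule_isNAAlg.Build F (gen_alg Y) (@gen_mulC Y) (@gen_mulDl Y)
    (@gen_mulZl Y).

Definition gen_elt (Y : set A) x (Yx : Y x) : gen_alg Y :=
  GenAlg (mem_set (sub_gen_set Yx) : x \in gen_pred Y).

Definition gen1 (x y : A) : gen_alg [set x; y] :=
  gen_elt (or_introl erefl : [set x; y] x).
Definition gen2 (x y : A) : gen_alg [set x; y] :=
  gen_elt (or_intror erefl : [set x; y] y).

End GeneratedSubalgebra.

(** Automorphisms act on the right: x^(g * h) = (x^g)^h. *)

Section Aut.
Variables (F : fieldType) (A : naAlgType F).

Record aut := MkAut { aut_fun :> A -> A ; autP : alg_iso aut_fun }.

HB.instance Definition _ := gen_eqMixin aut.
HB.instance Definition _ := gen_choiceMixin aut.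

Lemma autE (g h : aut) : g =1 h -> g = h.
Proof.
case: g h => [g gP] [h hP] /= /funext eq_gh.
by case: _ / eq_gh in hP *; rewrite (Prop_irrelevance gP hP).
Qed.

Fact aut_oneP : alg_iso (@id A).
Proof. by split=> //; exists id. Qed.

Fact aut_mulP (g h : aut) : alg_iso (h \o g).
Proof.
have [[gL gM] gB] := autP g; have [[hL hM] hB] := autP h.
split; last exact: bij_comp.
by split=> [k x y|x y] /=; rewrite ?gL ?hL ?gM ?hM.
Qed.

Fact aut_invP (g : aut) :
  alg_iso (fun y => xget 0 [set x | aut_fun g x = y] : A).
Proof.
have [[gL gM] [f gK fK]] := autP g.
have -> : (fun y => xget 0 [set x | aut_fun g x = y]) = f.
  apply/funext => y; apply: xget_unique => [|x /=]; first exact: fK.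
  by move=> <-; rewrite gK.
split; last by exists g.
split=> [k x y|x y]; apply: (can_inj gK); first by rewrite gL !fK.
by rewrite gM !fK.
Qed.

Definition aut_one := MkAut aut_oneP.
Definition aut_mul g h := MkAut (aut_mulP g h).
Definition aut_inv g := MkAut (aut_invP g).

Fact aut_mulA : associative aut_mul. Proof. by move=> g h k; apply: autE. Qed.
Fact aut_mul1g : left_id aut_one aut_mul. Proof. by move=> g; apply: autE. Qed.
Fact aut_mulg1 : right_id aut_one aut_mul. Proof. by move=> g; apply: autE. Qed.

Fact aut_mulgV : right_inverse aut_one aut_inv aut_mul.
Proof.
move=> g; apply: autE => x /=; have [_ [f gK _]] := autP g.
by apply: xget_unique => [//|y /= /(can_inj gK)].
Qed.

Fact aut_mulVg : left_inverse aut_one aut_inv aut_mul.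
Proof.
move=> g; apply: autE => x /=; have [_ [f _ fK]] := autP g.
by case: xgetP => [y _ //|/(_ (f x)) /=]; rewrite fK.
Qed.

HB.instance Definition _ :=
  isGroup.Build aut aut_mulA aut_mul1g aut_mulg1 aut_mulVg aut_mulgV.

Definition aut_act (x : A) (g : aut) : A := g x.

Definition aut_stab (S : set A) : set aut := [set g : aut | g @` S = S].

End Aut.

Record fusion_law (F : fieldType) := FusionLaw
  { law_dom : seq F ; law_op : F -> F -> seq F }.

(** [law_op] is only meaningful on [law_dom]. *)
Definition monster (F : fieldType) (alpha beta : F) : fusion_law F :=
  FusionLaw [:: 1; 0; alpha; beta] (fun l m =>
    if l == 1 then (if m == 0 then [::] else [:: m])
    else if l == 0 then (if m == 1 then [::] else [:: m])
    else if l == alpha then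
      (if m == alpha then [:: 1; 0] else if m == beta then [:: beta]
       else [:: alpha])
    else (if m == beta then [:: 1; 0; alpha] else [:: beta])).

Definition jordan (F : fieldType) (eta : F) : fusion_law F :=
  FusionLaw [:: 1; 0; eta] (fun l m =>
    if l == 1 then (if m == 0 then [::] else [:: m])
    else if l == 0 then (if m == 1 then [::] else [:: m])
    else (if m == eta then [:: 1; 0] else [:: eta])).

Section Axes.
Variables (F : fieldType) (A : naAlgType F).

Definition eigen (a : A) (l : F) : set A := [set v | a ** v = l *: v].

(** The sum of the eigenspaces of [a] with eigenvalues in [s]; it is direct
    when [s] is duplicate free. *)
Definition eigen_sum (a : A) (s : seq F) : set A :=
  [set v | exists2 w : F -> A,
     forall l, l \in s -> eigen a l (w l) & v = \sum_(l <- s) w l].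

(** Axes are nonzero: the idempotent 0 satisfies all the other conditions. *)
Definition axis (L : fusion_law F) (a : A) : Prop :=
  [/\ a != 0, a ** a = a, eigen_sum a (law_dom L) = setT &
      forall l m v w, l \in law_dom L -> m \in law_dom L ->
        eigen a l v -> eigen a m w -> eigen_sum a (law_op L l m) (v ** w)].

Definition primitive_axis (L : fusion_law F) (a : A) : Prop :=
  axis L a /\ eigen a 1 = [set k *: a | k in setT].

(** The automorphism acting as -1 on the eigenspaces of [a] for [minus] and
    as 1 on those for [plus] (it is 1 if there is no such automorphism). *)
Definition sign_aut (minus plus : seq F) (a : A) : aut A :=
  xget 1%g [set g : aut A |
    (forall l v, l \in minus -> eigen a l v -> g v = - v) /\
    (forall l v, l \in plus -> eigen a l v -> g v = v)].

Definition miyamoto (alpha beta : F) (a : A) : aut A :=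
  sign_aut [:: beta] [:: 1; 0; alpha] a.

(** The automorphism sigma_a of an M(alpha, beta)-axis [a] whose
    beta-eigenspace is zero. *)
Definition sigma (alpha : F) (a : A) : aut A :=
  sign_aut [:: alpha] [:: 1; 0] a.

End Axes.

(** The set of generating axes is part of the data, as in X(A). *)
Record axialAlg (F : fieldType) (alpha beta : F) := AxialAlg {
  ax_alg :> naAlgType F;
  ax_set : set ax_alg;
  ax_axis : forall x, ax_set x -> primitive_axis (monster alpha beta) x;
  ax_gen : gen_set ax_set = setT;
  ax_closed : forall x y, ax_set x -> ax_set y ->
    ax_set (miyamoto alpha beta x y)
}.

Definition is_subgroup (gT : groupType) (G : set gT) : Prop :=
  [/\ G 1%g, (forall g h, G g -> G h -> G (g * h)%g) &
      (forall g, G g -> G g^-1%g)].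

Record is_axet (T : Type) (gT : groupType) (act : T -> gT -> T) (G : set gT)
    (X : set T) (tau : T -> gT) : Prop := IsAxet {
  axet_subgroup : is_subgroup G;
  axet_act1 : forall x, X x -> act x 1%g = x;
  axet_actM : forall x g h, X x -> G g -> G h ->
    act x (g * h)%g = act (act x g) h;
  axet_stable : forall x g, X x -> G g -> X (act x g);
  axet_tau_in : forall x, X x -> G (tau x);
  axet_tau_fix : forall x, X x -> act x (tau x) = x;
  axet_tau2 : forall x, X x -> (tau x * tau x = 1)%g;
  axet_tauJ : forall x g, X x -> G g ->
    tau (act x g) = (g^-1 * tau x * g)%g
}.

(** The G-set and the group are subsets of ambient types, so that the axets
    of algebras are axets on the nose. *)
Record axet := Axet {
  axT : Type;
  axgT : groupType;
  axact : axT -> axgT -> axT;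
  axG : set axgT;
  axX : set axT;
  axtau : axT -> axgT;
  axP : is_axet axact axG axX axtau
}.

Arguments axX : clear implicits.
Arguments axG : clear implicits.

Section Axets.

Definition axet_closed (X : axet) (Y : set (axT X)) : Prop :=
  Y `<=` axX X /\ forall x y, Y x -> Y y -> Y (axact x (axtau y)).

Definition axet_gen (X : axet) (Y : set (axT X)) : set (axT X) :=
  smallest (@axet_closed X) Y.

(** [W] is a subaxet of [X], with the restriction of [axtau]; morphisms of axets
    involve only the Miyamoto maps, not the groups. *)
Definition axet_morphism_on (X Y : axet) (W : set (axT X))
    (f : axT X -> axT Y) : Prop :=
  set_fun W (axX Y) f /\
  (forall x y, W x -> W y -> f (axact y (axtau x)) = axact (f y) (axtau (f x))).

Definition axet_iso_on (X Y : axet) (W : set (axT X))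
    (f : axT X -> axT Y) : Prop :=
  axet_morphism_on W f /\ set_bij W (axX Y) f.

Definition axet_isomorphic (X Y : axet) : Prop :=
  exists f : axT X -> axT Y, axet_iso_on (axX X) f.

(** [x = y] is allowed: subaxets generated by one or two axes. *)
Definition X2gen (X : axet) : set (set (axT X)) :=
  [set W | exists x y, [/\ axX X x, axX X y & W = axet_gen [set x; y]]].

End Axets.

(** [(s, k)] is the affine map j |-> (-1)^s j + k of Z/n, acting on the right;
    'Z_n is Z/n only for n > 1. *)
Definition dihedral (n : nat) : Type := (bool * 'Z_n)%type.

HB.instance Definition _ n := Choice.on (dihedral n).

Section Dihedral.
Variable n : nat.
Implicit Types g h : dihedral n.

Definition dih_act (j : 'Z_n) (g : dihedral n) : 'Z_n := (-1) ^+ g.1 * j + g.2.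

Definition dih_one : dihedral n := (false, 0).
Definition dih_mul g h : dihedral n := (g.1 (+) h.1, dih_act g.2 h).
Definition dih_inv g : dihedral n := (g.1, - ((-1) ^+ g.1 * g.2)).

Fact dih_mulA : associative dih_mul.
Proof.
move=> [r i] [s j] [t k]; rewrite /dih_mul /dih_act /= addbA.
by rewrite mulrDr addrA mulrA signr_addb [(-1) ^+ s * _]mulrC.
Qed.

Fact dih_mul1g : left_id dih_one dih_mul.
Proof. by move=> [s j]; rewrite /dih_mul /dih_act /= mulr0 add0r. Qed.

Fact dih_mulg1 : right_id dih_one dih_mul.
Proof. by move=> [s j]; rewrite /dih_mul /dih_act /= addbF mul1r addr0. Qed.

Fact dih_mulVg : left_inverse dih_one dih_inv dih_mul.
Proof.
move=> [s j]; rewrite /dih_mul /dih_act /= addbb mulrN mulrA -signr_addb.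
by rewrite addbb mul1r addNr.
Qed.

Fact dih_mulgV : right_inverse dih_one dih_inv dih_mul.
Proof. by move=> [s j]; rewrite /dih_mul /dih_act /= addbb addrN. Qed.

HB.instance Definition _ := isGroup.Build (dihedral n)
  dih_mulA dih_mul1g dih_mulg1 dih_mulVg dih_mulgV.

Lemma dih_mulE g h : (g * h)%g = dih_mul g h. Proof. by []. Qed.
Lemma dih_invE g : (g^-1)%g = dih_inv g. Proof. by []. Qed.
Lemma dih_oneE : 1%g = dih_one. Proof. by []. Qed.

(** [None] is the fixed axis. *)
Definition fixed_act (x : option 'Z_n) (g : dihedral n) : option 'Z_n :=
  omap (dih_act^~ g) x.

(** j |-> 2i - j *)
Definition dih_refl (i : 'Z_n) : dihedral n := (true, i *+ 2).

Definition axet_tau_with (ta : dihedral n) (x : option 'Z_n) : dihedral n :=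
  oapp dih_refl ta x.

Lemma axet_withP (ta : dihedral n) :
  (ta * ta = 1)%g -> (forall g, ta = (g^-1 * ta * g)%g) ->
  is_axet fixed_act setT setT (axet_tau_with ta).
Proof.
move=> ta2 taJ; split=> //.
- by case=> [j|] _ //=; rewrite /dih_act /= mul1r addr0.
- case=> [j|] // [s i] [t k] _ _ _ /=; congr Some.
  by rewrite /dih_act /= signr_addb mulrDr addrA mulrA [(-1) ^+ s * _]mulrC.
- case=> [j|] // _ /=; congr Some; rewrite /dih_act /= expr1 mulN1r.
  by rewrite mulr2n addKr.
- case=> [j|] // _; rewrite dih_mulE dih_oneE /dih_mul /dih_act /=.
  by rewrite expr1 mulN1r addNr.
case=> [j|] // g _ _.
case: g => s k; rewrite [axet_tau_with _ _]/= [axet_tau_with _ (Some j)]/=.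
rewrite !dih_mulE dih_invE /dih_refl /dih_mul /dih_inv /dih_act /=.
congr pair; first by case: s.
rewrite expr1 mulN1r opprK !mulrDr mulrA -signr_addb addbb mul1r.
by rewrite mulrnDl !mulr2n [RHS]addrAC [LHS]addrC.
Qed.

End Dihedral.

Fact axX1_subproof n : is_axet (@fixed_act n) setT setT (axet_tau_with 1%g).
Proof. by apply: axet_withP => [|g]; rewrite ?mulg1 ?mulVg. Qed.

Definition axX1 (n : nat) : axet := Axet (axX1_subproof n).

(** j |-> j + h on Z/2h *)
Definition half_rot (h : nat) : dihedral h.*2 := (false, h%:R).

Fact axX2_subproof h :
  is_axet (@fixed_act h.*2) setT setT (axet_tau_with (half_rot h)).
Proof.
have hh : h%:R + h%:R = 0 :> 'Z_(h.*2).
  rewrite -natrD addnn; case: h => [|h]; first by [].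
  by apply: char_Zp; rewrite doubleS.
apply: axet_withP => [|[s k]].
  by rewrite dih_mulE dih_oneE /dih_mul /dih_act /= mul1r hh.
rewrite !dih_mulE dih_invE /dih_mul /dih_inv /dih_act /half_rot /=.
congr pair; first by case: s.
rewrite mul1r mulrDr mulrN mulrA -signr_addb addbb mul1r addrAC addNr add0r.
case: s; rewrite ?mul1r // expr1 mulN1r.
by apply/eqP; rewrite -subr_eq0 opprK hh.
Qed.

(** X_2(1+m) for m = 2h *)
Definition axX2 (h : nat) : axet := Axet (axX2_subproof h).

Section AxetOfAlgebra.
Variables (F : fieldType) (alpha beta : F) (A : axialAlg alpha beta).

Local Notation tau := (@miyamoto F A alpha beta).

Let is_tau (x : A) (g : aut A) : Prop :=
  (forall l v, l \in [:: beta] -> eigen x l v -> g v = - v) /\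
  (forall l v, l \in [:: 1; 0; alpha] -> eigen x l v -> g v = v).

Let aut0 (g : aut A) : g 0 = 0.
Proof.
have [[gL _] _] := autP g.
by have := gL (-1) 0 0; rewrite scaler0 addr0 scaleN1r addNr.
Qed.

Let autD (g : aut A) u v : g (u + v) = g u + g v.
Proof. by have [[gL _] _] := autP g; have := gL 1 u v; rewrite !scale1r. Qed.

Let autZ (g : aut A) k u : g (k *: u) = k *: g u.
Proof.
by have [[gL _] _] := autP g; have := gL k u 0; rewrite aut0 !addr0.
Qed.

Let autM (g : aut A) u v : g (u ** v) = g u ** g v.
Proof. by have [[_ gM] _] := autP g. Qed.

Let autN (g : aut A) u : g (- u) = - g u.
Proof. by rewrite -scaleN1r autZ scaleN1r. Qed.

Let autMg (g h : aut A) u : (g * h)%g u = h (g u).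
Proof. by []. Qed.

Let autKV (g : aut A) u : g (g^-1%g u) = u.
Proof. by rewrite -autMg mulVg. Qed.

Let autVK (g : aut A) u : g^-1%g (g u) = u.
Proof. by rewrite -autMg mulgV. Qed.

Let aut_sum (g : aut A) (s : seq F) (w : F -> A) :
  g (\sum_(l <- s) w l) = \sum_(l <- s) g (w l).
Proof. by rewrite (big_morph g (autD g) (aut0 g)). Qed.

Let is_tau_fun x g : ax_set x -> is_tau x g -> forall h, is_tau x h -> g = h.
Proof.
move=> /ax_axis[[_ _ dec _] _] [gm gp] h [hm hp]; apply: autE => v.
have : eigen_sum x (law_dom (monster alpha beta)) v by rewrite dec.
case=> w wP ->; rewrite !aut_sum; apply: eq_big_seq => l ld.
have := ld; rewrite (_ : law_dom _ = [:: 1; 0; alpha] ++ [:: beta]) //.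
rewrite mem_cat => /orP[lp|lm]; last by rewrite (gm l) ?(hm l) //; apply: wP.
by rewrite (gp l) ?(hp l) //; apply: wP.
Qed.

Let is_tau2 x g : ax_set x -> is_tau x g -> (g * g = 1)%g.
Proof.
move=> /ax_axis[[_ _ dec _] _] [gm gp]; apply: autE => v.
have : eigen_sum x (law_dom (monster alpha beta)) v by rewrite dec.
case=> w wP ->; rewrite !aut_sum; apply: eq_big_seq => l ld; rewrite autMg.
have := ld; rewrite (_ : law_dom _ = [:: 1; 0; alpha] ++ [:: beta]) //.
rewrite mem_cat => /orP[lp|lm].
  by rewrite !(gp l (w l) lp (wP l ld)).
by rewrite (gm l (w l) lm (wP l ld)) autN (gm l (w l) lm (wP l ld)) opprK.
Qed.

Let eigen_aut (g : aut A) x l v : eigen (g x) l v -> eigen x l (g^-1%g v).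
Proof.
by rewrite /eigen /= => E; rewrite -[x in LHS](autVK g) -autM E autZ.
Qed.

Let is_tauJ x (g h : aut A) : is_tau x h -> is_tau (g x) (g^-1 * h * g)%g.
Proof.
case=> [hm hp]; split=> l v ls /eigen_aut /[dup] E.
  by move=> /(hm _ _ ls); rewrite !autMg => ->; rewrite autN autKV.
by move=> /(hp _ _ ls); rewrite !autMg => ->; rewrite autKV.
Qed.

Let miyamoto_spec x : tau x = xget 1%g (is_tau x). Proof. by []. Qed.

Fact axet_of_subproof :
  is_axet (@aut_act F A) (aut_stab (@ax_set _ _ _ A)) (@ax_set _ _ _ A) tau.
Proof.
have tau2 x : ax_set x -> (tau x * tau x = 1)%g.
  move=> Xx; rewrite miyamoto_spec; case: xgetP => [g _|_]; last by rewrite mulg1.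
  exact: is_tau2.
split=> //.
- split=> [|g h gS hS|g gS]; rewrite /aut_stab.
  + by rewrite /= image_id.
  + by rewrite /= -[in RHS]hS -[in RHS]gS -image_comp.
  + apply/seteqP; split=> [y [x + <-]|y Xy].
      by rewrite -{1}gS => -[z Xz <-]; have /= -> := autVK g z.
    by exists (g y); [rewrite -gS; exists y|exact: autVK].
- by move=> x g Xx gS; rewrite -gS; exists x.
- move=> x Xx; apply/seteqP; split=> [y [z Xz <-]|y Xy]; first exact: ax_closed.
  exists (tau x y); first exact: ax_closed.
  by have := congr1 (fun g : aut A => g y) (tau2 x Xx).
- move=> x Xx; rewrite /aut_act miyamoto_spec; case: xgetP => [g _ [_ gp]|//].
  apply: (gp 1); first by rewrite inE eqxx.
  by have [[_ xx _ _] _] := ax_axis Xx; rewrite /eigen /= scale1r.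
move=> x g Xx gS; have Xgx : ax_set (g x) by rewrite -gS; exists x.
rewrite /aut_act !miyamoto_spec; case: (xgetP _ (is_tau x)) => [h _ hP|nP].
  have ghP : is_tau (g x) (g^-1 * h * g)%g by apply: is_tauJ.
  apply: (xget_unique _ ghP) => k kP; exact: is_tau_fun Xgx kP _ ghP.
have nPg k : ~ is_tau (g x) k.
  by move=> /(is_tauJ g^-1%g); rewrite autVK => /nP.
by rewrite (xgetPN _ nPg) mulg1 mulVg.
Qed.

Definition axet_of : axet := Axet axet_of_subproof.

End AxetOfAlgebra.

(** [sh_alg W] and [sh_map W] are only meaningful for [W] in [X2gen X], and
    [sh_map W] only on [W]. *)
Record axet_shape (F : fieldType) (alpha beta : F) (X : axet) := Shape {
  sh_alg : set (axT X) -> axialAlg alpha beta;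
  sh_map : forall W : set (axT X), axT X -> sh_alg W;
  sh_iso : forall W, X2gen W ->
    @axet_iso_on X (axet_of (sh_alg W)) W (sh_map W);
  sh_compat : forall g V W, axG X g -> X2gen V -> X2gen W ->
    [set axact v g | v in V] `<=` W ->
    exists phi : sh_alg V -> sh_alg W,
      [/\ alg_hom phi, injective phi &
          forall v, V v -> sh_map W (axact v g) = phi (sh_map V v)]
}.

Section Completion.
Variables (F : fieldType) (alpha beta : F) (X : axet).
Variables (Theta : axet_shape alpha beta X) (A : axialAlg alpha beta).
Variable psi : axT X -> A.

Definition completion : Prop :=
  [/\ @axet_morphism_on X (axet_of A) (axX X) psi,
      psi @` axX X = @ax_set _ _ _ A &
      forall W, X2gen W ->
        exists phi : sh_alg Theta W -> gen_alg (psi @` W),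
          alg_hom phi /\ forall x, W x -> phi (sh_map Theta W x) = psi x :> A].

(** The axes of X are identified with their images in [A], and each A_W with
    the subalgebra <<W>> of [A]. *)
Definition identified : Prop :=
  {in axX X &, injective psi} /\
  forall W, X2gen W ->
    exists phi : sh_alg Theta W -> gen_alg (psi @` W),
      alg_iso phi /\ forall x, W x -> phi (sh_map Theta W x) = psi x :> A.

End Completion.

Section TwoGenerated.
Variables (F : fieldType) (B : naAlgType F).

Definition gen_group (gT : groupType) (S : set gT) : set gT :=
  smallest (@is_subgroup gT) S.

Definition two_gen (L : fusion_law F) (x y : B) : Prop :=
  [/\ primitive_axis L x, primitive_axis L y & gen_set [set x; y] = setT].

Definition J2 (eta : F) : Prop := exists x y : B, two_gen (jordan eta) x y.

Definition symmetric_alg (alpha beta : F) (x y : B) : Prop :=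
  two_gen (monster alpha beta) x y /\
  exists g : aut B, [/\ g <> 1%g, (g * g = 1)%g, g x = y & g y = x].

(** The axet X(B) of an algebra [B] generated by the axes [x] and [y]. *)
Definition axet2 (alpha beta : F) (x y : B) : set B :=
  [set v | exists2 g : aut B,
     gen_group [set miyamoto alpha beta x; miyamoto alpha beta y] g &
     v = g x \/ v = g y].

End TwoGenerated.

Section Named.
Variable F : fieldType.

Definition alg1A : Type := F.
HB.instance Definition _ := GRing.Lmodule.copy alg1A F^o.

Definition mul1A (x y : alg1A) : alg1A := (x : F) * (y : F).

Fact mul1AC : commutative mul1A. Proof. exact: mulrC. Qed.
Fact mul1ADl : left_distributive mul1A +%R. Proof. exact: mulrDl. Qed.
Fact mul1AZl (k : F) x y : mul1A (k *: x) y = k *: mul1A x y.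
Proof. by rewrite /mul1A [RHS]mulrA. Qed.

HB.instance Definition _ :=
  Lmodule_isNAAlg.Build F alg1A mul1AC mul1ADl mul1AZl.

(** with basis the orthogonal idempotents (1, 0) and (0, 1) *)
Definition alg2B : Type := (alg1A * alg1A)%type.
HB.instance Definition _ := NAAlg.copy alg2B (alg1A * alg1A)%type.

(** The bilinear form on V = <u, v> with (u, u) = (v, v) = 2, (u, v) = delta,
    in coordinates. *)
Definition spin_form (delta : F) (w z : 'rV[F]_2) : F :=
  2%:R * (w 0 0 * z 0 0 + w 0 1 * z 0 1) +
  delta * (w 0 0 * z 0 1 + w 0 1 * z 0 0).

(** S(delta); [(s, w)] stands for s 1 + w *)
Definition spin (delta : F) : Type := (F^o * 'rV[F]_2)%type.
HB.instance Definition _ delta :=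
  GRing.Lmodule.copy (spin delta) (F^o * 'rV[F]_2)%type.

Definition spin_mul (delta : F) (x y : spin delta) : spin delta :=
  (x.1 * y.1 + 2%:R^-1 * spin_form delta x.2 y.2, x.1 *: y.2 + y.1 *: x.2).

Fact spin_mulC delta : commutative (@spin_mul delta).
Proof.
move=> [s w] [t z]; rewrite /spin_mul /spin_form /=.
congr pair; last exact: addrC.
have H (k a b c d h : F) (s' t' : F) :
    s' * t' + h * (2%:R * (a * c + b * d) + k * (a * d + b * c)) =
    t' * s' + h * (2%:R * (c * a + d * b) + k * (c * b + d * a)) by ring.
exact: H.
Qed.

Fact spin_mulDl delta : left_distributive (@spin_mul delta) +%R.
Proof.
move=> [s w] [t z] [r x]; rewrite /spin_mul /spin_form /= !mxE.
congr pair; last by rewrite scalerDl scalerDr addrACA.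
have H (k a b a' b' c d h s' t' r' : F) :
    (s' + t') * r' +
      h * (2%:R * ((a + a') * c + (b + b') * d) +
           k * ((a + a') * d + (b + b') * c)) =
    s' * r' + h * (2%:R * (a * c + b * d) + k * (a * d + b * c)) +
    (t' * r' + h * (2%:R * (a' * c + b' * d) + k * (a' * d + b' * c))) by ring.
exact: H.
Qed.

Fact spin_mulZl delta (k : F) (x y : spin delta) :
  spin_mul (k *: x) y = k *: spin_mul x y.
Proof.
case: x y => [s w] [t z]; rewrite /spin_mul /spin_form /= !mxE.
congr pair; last by rewrite scalerDr !scalerA [t * k]mulrC.
have H (e a b c d h s' t' : F) :
    k * s' * t' + h * (2%:R * (k * a * c + k * b * d) +
      e * (k * a * d + k * b * c)) =
    k * (s' * t' + h * (2%:R * (a * c + b * d) + e * (a * d + b * c)))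
  by ring.
exact: H.
Qed.

HB.instance Definition _ delta := Lmodule_isNAAlg.Build F (spin delta)
  (@spin_mulC delta) (@spin_mulDl delta) (@spin_mulZl delta).

(** [x] is an axis of S(delta) and [y] is its opposite. *)
Definition spin_opposite (delta : F) (x y : spin delta) : Prop :=
  exists w : 'rV[F]_2, [/\ spin_form delta w w = 2%:R,
    x = 2%:R^-1 *: ((1, w) : spin delta) &
    y = 2%:R^-1 *: ((1, - w) : spin delta)].

(** S(2)^o; [(s, t)] stands for s x + t y. *)
Definition spin2o : Type := (F^o * F^o)%type.
HB.instance Definition _ := GRing.Lmodule.copy spin2o (F^o * F^o)%type.

Definition spin2o_mul (p q : spin2o) : spin2o :=
  let m := 2%:R^-1 * (p.1 * q.2 + p.2 * q.1) in
  (p.1 * q.1 + m, p.2 * q.2 + m).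

Fact spin2o_mulC : commutative spin2o_mul.
Proof.
move=> [s t] [s' t']; rewrite /spin2o_mul /=.
have H (h a b c d e f : F) :
  e * f + h * (a * d + b * c) = f * e + h * (c * b + d * a) by ring.
by congr pair; apply: H.
Qed.

Fact spin2o_mulDl : left_distributive spin2o_mul +%R.
Proof.
move=> [s t] [s' t'] [s2 t2]; rewrite /spin2o_mul /=.
have H (h a b c d a' b' x x' y : F) :
  (x + x') * y + h * ((a + a') * d + (b + b') * c) =
  x * y + h * (a * d + b * c) + (x' * y + h * (a' * d + b' * c)) by ring.
by congr pair; apply: H.
Qed.

Fact spin2o_mulZl (k : F) (p q : spin2o) :
  spin2o_mul (k *: p) q = k *: spin2o_mul p q.
Proof.
case: p q => [s t] [s' t']; rewrite /spin2o_mul /=.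
have H (h a b c d x y : F) :
  k * x * y + h * (k * a * d + k * b * c) =
  k * (x * y + h * (a * d + b * c)) by ring.
by congr pair; apply: H.
Qed.

HB.instance Definition _ :=
  Lmodule_isNAAlg.Build F spin2o spin2o_mulC spin2o_mulDl spin2o_mulZl.

End Named.

(* Main.v *)
Require Import Defs.
From mathcomp Require Import all_boot all_order all_algebra.
From mathcomp Require Import ring.
From mathcomp Require Import boolp classical_sets functions.

Set Implicit Arguments.
Unset Strict Implicit.
Unset Printing Implicit Defensive.

(** In the completion the axes are [a] and the vertices [z i], for [i] in Z/n, of
    a polygon whose reflections are the Miyamoto involutions; the unit [d] of
    [X1_generators] allows to number them so that [b = z 0] and [c = z 1].
    The involution of [a] fixes all generators, so it is trivial, A_beta(a) = 0,
    and [a] satisfies the Jordan fusion law with its involution [sigma_a].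

    If [sigma_a = 1], then A = F a + A_0(a). An idempotent in the polygon
    has component 0 or [a] on F a, and in the second case it would absorb [a];
    hence the polygon lies in A_0(a), which yields the direct sum. As [n] is odd,
    a reflection swaps [b] and [c].

    Suppose that [sigma_a <> 1]. The reflections fix [a], so they commute with
    [sigma_a], and [z] and [z'] have the same Miyamoto involution; since [n] is
    odd, distinct vertices have distinct involutions. So the polygon and its
    image are disjoint, and together with [a] they form the axet X_2(1 + 2n)
    through the Chinese remainder isomorphism of Z/2n with Z/2 x Z/n.
    A reflection that swaps [b] and [c], followed by [sigma_a], swaps [b'] and
    [c], and [<<b', c>>] contains both polygons.

    It remains to decide when [a] lies in [<<b, b'>>]. In [<<a, b>>] both axes
    satisfy the Jordan fusion law, and this algebra is spanned by [a], [b] and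
    [s = ab - alpha (a + b)], where [s] acts as the scalar
    [pi = (1 - alpha) phi - alpha] and [phi] is the coefficient of the
    projection of [b] to [a] ([jordan_pairP], by the Seress lemma). The
    idempotency of [b] gives [(2 alpha - 1) (2 phi - alpha) = 0]
    ([jordan_phi]), and [a] is a combination of [b], [b'] and [bb'] unless
    [phi] is 0 or [alpha] ([opposite_gen]). The exceptions have
    [alpha = 1/2] and [phi] equal to 0 or 1/2; there [a], [b], [s] are
    independent and the multiplication table is that of S(4 phi - 2)
    ([spin_iso]). *)

Import GRing.Theory.

Local Open Scope classical_set_scope.
Local Open Scope ring_scope.

(** * Homomorphisms and generated subalgebras *)

Section Hom.
Variables (F : fieldType) (A B : naAlgType F) (f : A -> B).
Hypothesis f_hom : alg_hom f.

Lemma homD : {morph f : u v / u + v}.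
Proof. by move=> u v; have [fL _] := f_hom; have := fL 1 u v; rewrite !scale1r. Qed.

Lemma hom0 : f 0 = 0.
Proof. by apply: (addrI (f 0)); rewrite -homD !addr0. Qed.

Lemma homZ k : {morph f : u / k *: u}.
Proof. by move=> u; have [fL _] := f_hom; have := fL k u 0; rewrite hom0 !addr0. Qed.

Lemma homN : {morph f : u / - u}.
Proof. by move=> u; rewrite -scaleN1r homZ scaleN1r. Qed.

Lemma homB : {morph f : u v / u - v}.
Proof. by move=> u v; rewrite homD homN. Qed.

Lemma homM : {morph f : u v / u ** v}.
Proof. by case: f_hom. Qed.

Lemma hom_eigen a l v : eigen a l v -> eigen (f a) l (f v).
Proof. by rewrite /eigen /= => E; rewrite -homM E homZ. Qed.

Lemma alg_isoI : injective f -> (forall y, exists x, f x = y) -> alg_iso f.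
Proof.
move=> f_inj f_surj; split=> //.
have g_spec y : {x | f x = y} by apply: cid; apply: f_surj.
exists (fun y => sval (g_spec y)) => [x|y]; last exact: (svalP (g_spec y)).
by apply: f_inj; rewrite (svalP (g_spec _)).
Qed.

End Hom.

Lemma aut_hom (F : fieldType) (A : naAlgType F) (g : aut A) : alg_hom g.
Proof. by case: (autP g). Qed.

Lemma aut_inj (F : fieldType) (A : naAlgType F) (g : aut A) : injective g.
Proof. by case: (autP g) => _ /bij_inj. Qed.

Lemma autMg (F : fieldType) (A : naAlgType F) (g h : aut A) u :
  (g * h)%g u = h (g u).
Proof. by []. Qed.

Lemma autK (F : fieldType) (A : naAlgType F) (g : aut A) :
  cancel g (g^-1)%g.
Proof. by move=> u; rewrite -autMg mulgV. Qed.

Lemma autVK (F : fieldType) (A : naAlgType F) (g : aut A) :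
  cancel (g^-1)%g g.
Proof. by move=> u; rewrite -autMg mulVg. Qed.

Lemma alg_isomorphic_sym (F : fieldType) (A B : naAlgType F) :
  A ~= B -> B ~= A.
Proof.
case=> f [f_hom [g fK gK]]; exists g; split; last by exists f.
split=> [k x y|x y]; apply: (can_inj fK); rewrite gK.
  by rewrite (homD f_hom) (homZ f_hom) !gK.
by rewrite (homM f_hom) !gK.
Qed.

Definition subspace (F : fieldType) (A : naAlgType F) (S : set A) : Prop :=
  S 0 /\ forall k x y, S x -> S y -> S (k *: x + y).

Section Subspace.
Variables (F : fieldType) (A : naAlgType F) (S : set A).
Hypothesis S_sub : subspace S.

Lemma subspaceZ k x : S x -> S (k *: x).
Proof. by case: S_sub => S0 SL Sx; rewrite -[k *: x]addr0; apply: SL. Qed.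

Lemma subspaceD x y : S x -> S y -> S (x + y).
Proof. by case: S_sub => S0 SL Sx Sy; rewrite -[x]scale1r; apply: SL. Qed.

Lemma subspaceN x : S x -> S (- x).
Proof. by move=> Sx; rewrite -scaleN1r; apply: subspaceZ. Qed.

Lemma subspaceB x y : S x -> S y -> S (x - y).
Proof. by move=> Sx Sy; apply: subspaceD => //; apply: subspaceN. Qed.

Lemma subspace_sum (I : eqType) (s : seq I) (w : I -> A) :
  (forall i, i \in s -> S (w i)) -> S (\sum_(i <- s) w i).
Proof.
move=> Sw; rewrite big_seq; elim/big_rec: _ => [|i x si]; first by case: S_sub.
by apply: subspaceD; apply: Sw.
Qed.

End Subspace.

Section Generated.
Variables (F : fieldType) (A : naAlgType F).
Implicit Types (S Y : set A) (x y : A).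

Lemma subalgebra_subspace S : is_subalgebra S -> subspace S.
Proof. by case=> S0 SL _; split. Qed.

Lemma gen_subspace Y : subspace (gen_set Y).
Proof. by apply: subalgebra_subspace; apply: gen_set_subalgebra. Qed.

Lemma gen_setM Y x y : gen_set Y x -> gen_set Y y -> gen_set Y (x ** y).
Proof. by have [_ _] := gen_set_subalgebra Y; apply. Qed.

Lemma gen_set_min Y S : is_subalgebra S -> Y `<=` S -> gen_set Y `<=` S.
Proof. by move=> S_alg YS x; apply. Qed.

Lemma gen_set_sub Y1 Y2 : Y1 `<=` gen_set Y2 -> gen_set Y1 `<=` gen_set Y2.
Proof. by apply: gen_set_min; apply: gen_set_subalgebra. Qed.

Lemma gen_set_fst x y : gen_set [set x; y] x.
Proof. by apply: sub_gen_set; left. Qed.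

Lemma gen_set_snd x y : gen_set [set x; y] y.
Proof. by apply: sub_gen_set; right. Qed.

Lemma gen_valE Y (v : gen_alg Y) : gen_set Y (gen_val v).
Proof. by apply: set_mem; apply: (gen_valP v). Qed.

Lemma gen_val_inj Y : injective (@gen_val F A Y).
Proof. exact: val_inj. Qed.

Lemma gen_val_hom Y : alg_hom (@gen_val F A Y).
Proof. by []. Qed.

Lemma gen_valK Y x : gen_set Y x -> exists v : gen_alg Y, gen_val v = x.
Proof. by move=> Yx; exists (GenAlg (mem_set Yx)). Qed.

Lemma aut_eq_gen Y (g h : aut A) :
  gen_set Y = setT -> (forall y, Y y -> g y = h y) -> g = h.
Proof.
move=> YT gh; apply: autE => x.
have: gen_set Y x by rewrite YT.
apply: (@gen_set_min _ [set x | g x = h x]) => //; split=> /=.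
- by rewrite !hom0 //; apply: aut_hom.
- by move=> k u v Eu Ev; rewrite !(homD (aut_hom _)) !(homZ (aut_hom _)) Eu Ev.
- by move=> u v Eu Ev; rewrite !(homM (aut_hom _)) Eu Ev.
Qed.

End Generated.

Section GeneratedAlgebra.
Variables (F : fieldType) (A : naAlgType F).
Implicit Types (S Y : set A) (x y : A).

Lemma gen_alg_gen Y (Y0 : set (gen_alg Y)) :
  (forall y, Y y -> exists2 v, Y0 v & gen_val v = y) -> gen_set Y0 = setT.
Proof.
move=> Y0Y; apply/seteqP; split=> // v _.
suff : [set u | exists2 w, gen_set Y0 w & gen_val w = u] (gen_val v).
  by case=> w Yw /gen_val_inj<-.
apply: (gen_set_min _ _ (gen_valE v)) => [|y /Y0Y[w Yw <-]]; last first.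
  by exists w => //; apply: sub_gen_set.
split=> [|k _ _ [u Yu <-] [w Yw <-]|_ _ [u Yu <-] [w Yw <-]].
- by exists 0 => //; case: (gen_set_subalgebra Y0).
- by exists (k *: u + w) => //; have [_ YL _] := gen_set_subalgebra Y0; apply: YL.
- by exists (u ** w) => //; apply: (gen_setM Yu Yw).
Qed.

(** The subalgebras below are identified through an explicit parametrization
    whose values lie in the ambient algebra. *)
Lemma corestrict_iso (D : naAlgType F) (f : D -> A) Y :
    alg_hom f -> injective f ->
    (forall d, gen_set Y (f d)) -> (forall y, Y y -> exists d, f d = y) ->
  exists2 h : D -> gen_alg Y, alg_iso h & forall d, gen_val (h d) = f d.
Proof.
move=> f_hom f_inj fY Yf.
exists (fun d => GenAlg (mem_set (fY d))) => //; apply: alg_isoI.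
- split=> [k x y|x y]; apply: gen_val_inj => /=.
    by rewrite (homD f_hom) (homZ f_hom).
  by rewrite (homM f_hom).
- by move=> x y /(congr1 (@gen_val _ _ _))/f_inj.
move=> v; have [x fx] : range f (gen_val v); last by exists x; apply: gen_val_inj.
apply: (gen_set_min _ _ (gen_valE v)) => [|y /Yf[d <-]]; last by exists d.
split=> [|k _ _ [x _ <-] [y _ <-]|_ _ [x _ <-] [y _ <-]].
- by exists 0; rewrite ?hom0.
- by exists (k *: x + y); rewrite // (homD f_hom) (homZ f_hom).
- by exists (x ** y); rewrite // (homM f_hom).
Qed.

(** An involution that preserves a subalgebra is invertible on it. *)
Lemma restrict_aut Y (g : aut A) : (g * g)%g = 1%g ->
    (forall y, Y y -> gen_set Y (g y)) ->
  exists h : aut (gen_alg Y), forall v, gen_val (h v) = g (gen_val v).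
Proof.
move=> gg gY; have gYs v : gen_set Y v -> gen_set Y (g v).
  apply: (@gen_set_min _ _ Y [set u | gen_set Y (g u)]) => //; split=> /=.
  - by rewrite hom0; [case: (gen_subspace Y)|apply: aut_hom].
  - move=> k u w Yu Yw; rewrite (homD (aut_hom g)) (homZ (aut_hom g)).
    by case: (gen_subspace Y) => _; apply.
  - by move=> u w Yu Yw; rewrite (homM (aut_hom g)); apply: (gen_setM Yu Yw).
pose h (v : gen_alg Y) := GenAlg (mem_set (gYs _ (gen_valE v))).
have hK : involutive h.
  by move=> v; apply: gen_val_inj => /=; rewrite -autMg gg.
suff hP : alg_iso h by exists (MkAut hP).
split; last by exists h.
split=> [k x y|x y]; apply: gen_val_inj => /=.
  by rewrite (homD (aut_hom g)) (homZ (aut_hom g)).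
by rewrite (homM (aut_hom g)).
Qed.

End GeneratedAlgebra.

(** * Eigenspaces, gradings and sign automorphisms *)

Section Eigen.
Variables (F : fieldType) (A : naAlgType F).
Implicit Types (a u v : A) (S : set A) (s : seq F).

Lemma eigen_subspace a l : subspace (eigen a l).
Proof.
split=> [|k u v]; first by rewrite /eigen /= amulC amul0r scaler0.
rewrite /eigen /= => Eu Ev.
by rewrite amulDr amulZr Eu Ev scalerDr !scalerA mulrC.
Qed.

Lemma eigen_sum_subspace a s : subspace (eigen_sum a s).
Proof.
split=> [|k _ _ [w wE ->] [w' w'E ->]].
  exists (fun _ => 0); last by rewrite big1.
  by move=> l _; case: (eigen_subspace a l).
exists (fun l => k *: w l + w' l) => [l ls|].
  by case: (eigen_subspace a l) => _; apply; [apply: wE|apply: w'E].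
by rewrite big_split scaler_sumr.
Qed.

Lemma eigen_sum_min a s S : subspace S ->
  (forall l, l \in s -> eigen a l `<=` S) -> eigen_sum a s `<=` S.
Proof.
move=> S_sub sS _ [w wE ->]; apply: subspace_sum => // l ls.
by apply: sS ls _ (wE l ls).
Qed.

Lemma eigen_sum_eigen a s l : uniq s -> l \in s -> eigen a l `<=` eigen_sum a s.
Proof.
move=> s_uniq ls v lv; exists (fun k => if k == l then v else 0) => [k _|].
  by case: eqP => [->//|_]; case: (eigen_subspace a k).
by rewrite (bigD1_seq l) //= eqxx big1 ?addr0 // => k /negPf->.
Qed.

Lemma eigen_sum_incl a s t : uniq t -> {subset s <= t} ->
  eigen_sum a s `<=` eigen_sum a t.
Proof.
move=> t_uniq st; apply: eigen_sum_min (eigen_sum_subspace a t) _ => l ls.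
by apply: eigen_sum_eigen => //; apply: st.
Qed.

Lemma eigen_sum1 a l v : eigen_sum a [:: l] v -> eigen a l v.
Proof.
apply: eigen_sum_min (eigen_subspace a l) _ _ => m.
by rewrite inE => /eqP->.
Qed.

Lemma eigen_sum_single a l v : eigen a l v -> eigen_sum a [:: l] v.
Proof. by apply: eigen_sum_eigen; rewrite ?mem_head. Qed.

Lemma eigen_sum_cat a s t v : eigen_sum a (s ++ t) v ->
  exists u w, [/\ eigen_sum a s u, eigen_sum a t w & v = u + w].
Proof.
case=> w wE ->; rewrite big_cat /=.
exists (\sum_(l <- s) w l), (\sum_(l <- t) w l).
by split=> //; exists w => // l ls; apply: wE; rewrite mem_cat ls ?orbT.
Qed.

(** Multiplying by [a] and subtracting [l] times the vector removes the
    [l]-component and rescales the others by nonzero scalars. *)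
Lemma eigen_component a S s (w : F -> A) :
    subspace S -> (forall v, S v -> S (a ** v)) -> uniq s ->
    (forall l, l \in s -> eigen a l (w l)) -> S (\sum_(l <- s) w l) ->
  forall l, l \in s -> S (w l).
Proof.
move=> S_sub aS; elim: s w => [//|l s IHs] w /= /andP[ls s_uniq] wE Sw.
have Ss : forall m, m \in s -> S (w m).
  move=> m ms; have ml : m - l != 0.
    by rewrite subr_eq0; apply: contraNneq ls => <-.
  rewrite -(scalerK ml (w m)); apply: subspaceZ => //.
  apply: (IHs (fun m => (m - l) *: w m)) => // [k ks|].
    by apply: subspaceZ; [apply: eigen_subspace|apply: wE; rewrite inE ks orbT].
  have -> : \sum_(m <- s) (m - l) *: w m =
      a ** (\sum_(m <- l :: s) w m) - l *: (\sum_(m <- l :: s) w m).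
    have aD : {morph amul a : u v / u + v} by apply: amulDr.
    have a0 : a ** 0 = 0 by rewrite amulC amul0r.
    rewrite (big_morph (amul a) aD a0) scaler_sumr !big_cons.
    rewrite (wE l) ?mem_head // opprD addrACA subrr add0r -sumrN -big_split /=.
    by apply: eq_big_seq => k ks; rewrite scalerBl wE // inE ks orbT.
  by apply: subspaceB => //; [apply: aS|apply: subspaceZ].
move=> m; rewrite inE => /predU1P[->|]; last exact: Ss.
move: Sw; rewrite big_cons => Sw.
rewrite -[w l](addrK (\sum_(j <- s) w j)); apply: subspaceB => //.
exact: subspace_sum.
Qed.

Lemma subspace0 : subspace [set 0 : A].
Proof. by split=> [|k x y] /= => [|-> ->]; rewrite // scaler0 addr0. Qed.

Lemma eigen_direct a s t u w : uniq (s ++ t) ->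
  eigen_sum a s u -> eigen_sum a t w -> u + w = 0 -> u = 0 /\ w = 0.
Proof.
move=> st_uniq [f fE ->] [g gE ->] E.
move: (st_uniq); rewrite cat_uniq => /and3P[_ /hasPn s_t _].
pose h l := if l \in s then f l else g l.
have hs : \sum_(l <- s) f l = \sum_(l <- s) h l.
  by apply: eq_big_seq => l ls; rewrite /h ls.
have ht : \sum_(l <- t) g l = \sum_(l <- t) h l.
  by apply: eq_big_seq => l lt; rewrite /h (negPf (s_t l lt)).
have h0 l : l \in s ++ t -> h l = 0.
  apply: (eigen_component subspace0 _ st_uniq) => [v /= ->|{}l lst|].
  - by rewrite amulC amul0r.
  - move: lst; rewrite mem_cat /h; case: ifP => [ls _|_ /= lt].
      exact: fE.
    exact: gE.
  - by rewrite big_cat /= -hs -ht.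
by rewrite hs ht !big_seq !big1 // => l ls; apply: h0; rewrite mem_cat ls ?orbT.
Qed.

(** [P] and [M] are the even and the odd part of a grading by the group of
    order 2: the parity of a product is the sum of the parities, so changing
    the sign of the odd part respects products. *)
Lemma grading_aut (P M : set A) :
    subspace P -> subspace M ->
    (forall v, exists p m, [/\ P p, M m & v = p + m]) ->
    (forall p m, P p -> M m -> p + m = 0 -> p = 0 /\ m = 0) ->
    (forall p q, P p -> P q -> P (p ** q)) ->
    (forall p m, P p -> M m -> M (p ** m)) ->
    (forall m q, M m -> M q -> P (m ** q)) ->
  exists g : aut A,
    (forall m, M m -> g m = - m) /\ (forall p, P p -> g p = p).
Proof.
move=> Psub Msub dec dir PP PM MM.
have decT v : {pm : A * A | [/\ P pm.1, M pm.2 & v = pm.1 + pm.2]}.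
  by apply: cid; have [p [m pmE]] := dec v; exists (p, m).
pose g v := (sval (decT v)).1 - (sval (decT v)).2.
have gE p m : P p -> M m -> g (p + m) = p - m.
  rewrite /g; case: (decT _) => -[p' m'] [/= Pp' Mm' E] Pp Mm.
  have [] := dir (p' - p) (m' - m).
  - exact: subspaceB.
  - exact: subspaceB.
  - by rewrite addrACA -opprD -E subrr.
  by move=> /subr0_eq-> /subr0_eq->.
have gK : involutive g.
  move=> v; have [p [m [Pp Mm ->]]] := dec v.
  by rewrite gE // gE ?opprK //; apply: subspaceN.
have gP : alg_iso g.
  split; last by exists g.
  split=> [k u v|u v].
    have [p [m [Pp Mm ->]]] := dec u; have [q [n [Pq Mn ->]]] := dec v.
    rewrite scalerDr addrACA !gE //.
    - by rewrite scalerBr addrACA opprD.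
    - by case: Psub => _; apply.
    - by case: Msub => _; apply.
  have [p [m [Pp Mm ->]]] := dec u; have [q [n [Pq Mn ->]]] := dec v.
  have mulDD (x y z t : A) :
      (x + y) ** (z + t) = (x ** z + y ** t) + (x ** t + z ** y).
    by rewrite amulDl !amulDr [z ** y]amulC [y ** z + _]addrC addrACA.
  rewrite !gE // !mulDD gE.
  - congr (_ + _).
      by rewrite -!scaleN1r amulZl amulZr !scalerA mulrNN mul1r scale1r.
    by rewrite opprD -!scaleN1r !amulZr.
  - by apply: subspaceD => //; [apply: PP|apply: MM].
  - by apply: subspaceD => //; apply: PM.
have P0 : P 0 by case: Psub.
have M0 : M 0 by case: Msub.
exists (MkAut gP); split=> /= [m Mm|p Pp].
  by rewrite -[m in g m]add0r gE // add0r.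
by rewrite -[p in g p]addr0 gE // subr0.
Qed.

End Eigen.

Section SignAut.
Variables (F : fieldType) (A : naAlgType F).
Implicit Types (L : fusion_law F) (a : A) (g h : aut A) (plus minus : seq F).

Definition acts_by_sign minus plus a g : Prop :=
  (forall l v, l \in minus -> eigen a l v -> g v = - v) /\
  (forall l v, l \in plus -> eigen a l v -> g v = v).

Definition fusion_closed L (s t r : seq F) : bool :=
  all (fun l => all (fun m => all [in r] (law_op L l m)) t) s.

Lemma axis_fusion L a (s t r : seq F) u v :
    axis L a -> fusion_closed L s t r -> uniq r ->
    {subset s <= law_dom L} -> {subset t <= law_dom L} ->
  eigen_sum a s u -> eigen_sum a t v -> eigen_sum a r (u ** v).
Proof.
move=> [_ _ _ aL] str r_uniq sL tL [f fE ->] tv.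
have rsub := eigen_sum_subspace a r.
have mulv0 : 0 ** v = 0 by rewrite amul0r.
have mulvD : {morph amul^~ v : x y / x + y} by move=> x y; rewrite amulDl.
rewrite (big_morph _ mulvD mulv0); apply: subspace_sum => // l ls.
case: tv => g gE ->.
have mul0 : f l ** 0 = 0 by rewrite amulC amul0r.
rewrite (big_morph _ (amulDr (f l)) mul0); apply: subspace_sum => // m mt.
have := aL l m _ _ (sL _ ls) (tL _ mt) (fE l ls) (gE m mt).
apply: eigen_sum_incl => // k klm.
by move/allP: str => /(_ l ls)/allP/(_ m mt)/allP/(_ k klm).
Qed.

Definition sign_graded L minus plus : bool :=
  [&& law_dom L == plus ++ minus, uniq (plus ++ minus),
      fusion_closed L plus plus plus, fusion_closed L plus minus minus &
      fusion_closed L minus minus plus].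

Lemma sign_autP L minus plus a : axis L a -> sign_graded L minus plus ->
  acts_by_sign minus plus a (sign_aut minus plus a).
Proof.
move=> aL /and5P[/eqP domL dom_uniq PP PM MM].
have pL : {subset plus <= law_dom L} by move=> l lp; rewrite domL mem_cat lp.
have mL : {subset minus <= law_dom L}.
  by move=> l lp; rewrite domL mem_cat lp orbT.
have [p_uniq m_uniq] : uniq plus /\ uniq minus.
  by move: dom_uniq; rewrite cat_uniq => /and3P[].
have [g [gm gp]] : exists g : aut A,
   (forall m, eigen_sum a minus m -> g m = - m) /\
   (forall p, eigen_sum a plus p -> g p = p).
  apply: grading_aut; try exact: eigen_sum_subspace.
  - move=> v; apply: eigen_sum_cat; rewrite -domL.
    by case: aL => _ _ -> _.
  - by move=> p m ap am; apply: eigen_direct ap am.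
  - by move=> p q; apply: axis_fusion PP _ _ _.
  - by move=> p q; apply: axis_fusion PM _ _ _.
  - by move=> p q; apply: axis_fusion MM _ _ _.
rewrite /sign_aut; case: xgetP => [h -> //|/(_ g)[]]; split=> l v ls lv.
  by apply: gm; apply: eigen_sum_eigen lv.
by apply: gp; apply: eigen_sum_eigen lv.
Qed.

Lemma acts_by_sign_uniq minus plus a g h :
    eigen_sum a (plus ++ minus) = setT ->
  acts_by_sign minus plus a g -> acts_by_sign minus plus a h -> g = h.
Proof.
move=> dec [gm gp] [hm hp]; apply: autE => v.
have : eigen_sum a (plus ++ minus) v by rewrite dec.
apply: (@eigen_sum_min _ _ _ _ [set v | g v = h v]) => [|l].
  split=> /= [|k x y Ex Ey]; first by rewrite !hom0 //; apply: aut_hom.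
  by rewrite !(homD (aut_hom _)) !(homZ (aut_hom _)) Ex Ey.
rewrite mem_cat => /orP[] ls w lw /=.
  by rewrite (gp l w) ?(hp l w).
by rewrite (gm l w) ?(hm l w).
Qed.

Lemma acts_by_sign_conj minus plus a g h : acts_by_sign minus plus a h ->
  acts_by_sign minus plus (g a) (g^-1 * h * g)%g.
Proof.
move=> [hm hp]; split=> l v ls /(hom_eigen (aut_hom g^-1%g)); rewrite autK.
  by move/(hm _ _ ls); rewrite !autMg => ->; rewrite (homN (aut_hom g)) autVK.
by move/(hp _ _ ls); rewrite !autMg => ->; rewrite autVK.
Qed.

Lemma sign_autJ L minus plus a g : axis L a -> sign_graded L minus plus ->
  sign_aut minus plus (g a) = (g^-1 * sign_aut minus plus a * g)%g.
Proof.
move=> aL Lg; have signP := sign_autP aL Lg.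
have [_ _ dec _] := aL; have /and5P[/eqP domL _ _ _ _] := Lg.
apply: xget_unique => [|h hP]; first exact: acts_by_sign_conj.
have := acts_by_sign_conj g^-1%g hP; rewrite autK invgK => hP'.
rewrite domL in dec; rewrite -(acts_by_sign_uniq dec hP' signP).
by rewrite !mulgA mulVg mul1g -mulgA mulVg mulg1.
Qed.

Lemma sign_aut2 L minus plus a : axis L a -> sign_graded L minus plus ->
  (sign_aut minus plus a * sign_aut minus plus a)%g = 1%g.
Proof.
move=> aL Lg; have [sm sp] := sign_autP aL Lg.
have [_ _ dec _] := aL; have /and5P[/eqP domL _ _ _ _] := Lg.
rewrite domL in dec; set g := sign_aut minus plus a.
suff gg : eigen_sum a (plus ++ minus) `<=` [set v | g (g v) = v].
  by apply: autE => v; apply: gg; rewrite dec.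
have g_hom := aut_hom g; apply: eigen_sum_min => [|l].
  split=> /= [|k x y Ex Ey]; first by rewrite !(hom0 g_hom).
  by rewrite !(homD g_hom) !(homZ g_hom) Ex Ey.
rewrite mem_cat => /orP[] ls w lw /=; first by rewrite /g !(sp l w).
by rewrite /g (sm l w) // (homN (aut_hom _)) (sm l w) // opprK.
Qed.

(** The subalgebra is stable under multiplication by its element [a], hence it
    contains the eigencomponents of its vectors. *)
Lemma sign_aut_stable L minus plus a S : axis L a -> sign_graded L minus plus ->
  is_subalgebra S -> S a -> forall v, S v -> S (sign_aut minus plus a v).
Proof.
move=> aL Lg S_alg Sa v Sv; have [sm sp] := sign_autP aL Lg.
have [_ _ dec _] := aL; have /and5P[/eqP domL dom_uniq _ _ _] := Lg.
rewrite domL in dec.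
have [w wE vE] : eigen_sum a (plus ++ minus) v by rewrite dec.
have S_sub := subalgebra_subspace S_alg.
have Sw : forall l, l \in plus ++ minus -> S (w l).
  apply: (eigen_component S_sub _ dom_uniq wE); last by rewrite -vE.
  by move=> u Su; case: S_alg => _ _; apply.
have g_hom := aut_hom (sign_aut minus plus a).
rewrite vE (big_morph _ (homD g_hom) (hom0 g_hom)); apply: subspace_sum => // l ls.
have := ls; rewrite mem_cat => /orP[] ls'.
  by rewrite (sp l) //; [apply: Sw|apply: wE].
by rewrite (sm l) //; [apply: subspaceN => //; apply: Sw|apply: wE].
Qed.

End SignAut.

Lemma acts_by_sign_restrict (F : fieldType) (A : naAlgType F) (Y : set A)
    minus plus (x : gen_alg Y) (h : aut (gen_alg Y)) (g : aut A) :
    (forall v, gen_val (h v) = g (gen_val v)) ->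
  acts_by_sign minus plus (gen_val x) g -> acts_by_sign minus plus x h.
Proof.
move=> hg [gm gp]; split=> l v ls /(hom_eigen (@gen_val_hom F A Y)) lv;
  apply: gen_val_inj; rewrite hg; [exact: gm lv|exact: gp lv].
Qed.

Section RestrictAxis.
Variables (F : fieldType) (A : naAlgType F) (Y : set A).
Implicit Types (x v : gen_alg Y) (L : fusion_law F).

Lemma eigen_restrict x l v :
  eigen x l v <-> eigen (gen_val x) l (gen_val v).
Proof.
split; first exact: (hom_eigen (@gen_val_hom F A Y)).
by move=> E; apply: gen_val_inj.
Qed.

(** The components are those of the ambient algebra: they lie in the subalgebra
    by [eigen_component]. *)
Lemma eigen_sum_restrict x (s : seq F) v : uniq s ->
  eigen_sum (gen_val x) s (gen_val v) -> eigen_sum x s v.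
Proof.
move=> s_uniq [w wE vE].
have Yw : forall l, l \in s -> gen_set Y (w l).
  apply: (eigen_component (gen_subspace Y) _ s_uniq wE).
    by move=> u; apply: gen_setM; apply: gen_valE.
  by rewrite -vE; apply: gen_valE.
have w_lift l : {u : gen_alg Y | l \in s -> gen_val u = w l}.
  apply: cid; have [/Yw/gen_valK[u uE]|_] := boolP (l \in s); first by exists u.
  by exists 0.
exists (fun l => sval (w_lift l)) => [l ls|].
  by apply/eigen_restrict; rewrite (svalP (w_lift l)) //; apply: wE.
have v_hom := @gen_val_hom F A Y; apply: gen_val_inj.
rewrite vE (big_morph _ (homD v_hom) (hom0 v_hom)).
by apply: eq_big_seq => l ls; rewrite (svalP (w_lift l)).
Qed.

Lemma restrict_axis L x : uniq (law_dom L) ->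
    (forall l m, uniq (law_op L l m)) ->
  axis L (gen_val x) -> axis L x.
Proof.
move=> dom_uniq op_uniq [x0 xx dec fus]; split.
- by apply: contraNneq x0 => ->.
- exact: gen_val_inj.
- apply/seteqP; split=> // v _; apply: eigen_sum_restrict => //.
  by rewrite dec.
- move=> l m v w lL mL /eigen_restrict lv /eigen_restrict mw.
  by apply: eigen_sum_restrict => //; apply: fus lv mw.
Qed.

Lemma restrict_primitive_axis L x : uniq (law_dom L) ->
    (forall l m, uniq (law_op L l m)) ->
  primitive_axis L (gen_val x) -> primitive_axis L x.
Proof.
move=> dom_uniq op_uniq [xL prim]; split; first exact: restrict_axis.
apply/seteqP; split=> [v /eigen_restrict|v [k _ <-]].
  by rewrite prim => -[k _ kx]; exists k => //; apply: gen_val_inj.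
by apply/eigen_restrict; rewrite prim; exists k.
Qed.

End RestrictAxis.

(** * The Monster and Jordan fusion laws *)

Section Laws.
Variables (F : fieldType) (alpha beta : F).
Hypothesis distinct : uniq [:: 1; 0; alpha; beta].
Variable A : naAlgType F.
Implicit Types (a v y : A).

Let law_eqs : (((1 == 0 :> F) = false) * ((0 == 1 :> F) = false)) *
  (((alpha == 1) = false) * ((1 == alpha) = false) *
   ((alpha == 0) = false) * ((0 == alpha) = false)) *
  (((beta == 1) = false) * ((1 == beta) = false) *
   ((beta == 0) = false) * ((0 == beta) = false) *
   ((beta == alpha) = false) * ((alpha == beta) = false)).
Proof.
rewrite !(eq_sym alpha) !(eq_sym beta) (eq_sym 0 1) oner_eq0.
move: distinct; rewrite /= !inE !negb_or.
move=> /and4P[/and3P[_ /negPf a1 /negPf b1] /andP[/negPf a0 /negPf b0] /negPf ab _].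
by rewrite !(eq_sym _ alpha) !(eq_sym _ beta) in a1 b1 a0 b0 ab *;
  rewrite ?a1 ?a0 ?b1 ?b0 ?ab.
Qed.

Lemma alpha_neq0 : alpha != 0.
Proof. by rewrite law_eqs. Qed.

Lemma alpha_neq1 : alpha != 1.
Proof. by rewrite law_eqs. Qed.

Lemma monster_graded :
  sign_graded (monster alpha beta) [:: beta] [:: 1; 0; alpha].
Proof.
rewrite /sign_graded /fusion_closed /= !(inE, eqxx, law_eqs) /=.
by rewrite !(inE, eqxx, law_eqs).
Qed.

Lemma jordan_graded : sign_graded (jordan alpha) [:: alpha] [:: 1; 0].
Proof.
rewrite /sign_graded /fusion_closed /= !(inE, eqxx, law_eqs) /=.
by rewrite !(inE, eqxx, law_eqs).
Qed.

Lemma fusion10 :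
  fusion_closed (monster alpha beta) [:: 1; 0] [:: 1; 0] [:: 1; 0].
Proof.
rewrite /fusion_closed /= !(inE, eqxx, law_eqs) /=.
by rewrite !(inE, eqxx, law_eqs).
Qed.

Lemma fusion00 : fusion_closed (monster alpha beta) [:: 0] [:: 0] [:: 0].
Proof.
rewrite /fusion_closed /= !(inE, eqxx, law_eqs) /=.
by rewrite ?(inE, eqxx, law_eqs).
Qed.

Lemma fusion_alpha :
  fusion_closed (monster alpha beta) [:: alpha] [:: alpha] [:: 1; 0].
Proof.
rewrite /fusion_closed /= !(inE, eqxx, law_eqs) /=.
by rewrite !(inE, eqxx, law_eqs).
Qed.

Lemma monster_op_uniq l m : uniq (law_op (monster alpha beta) l m).
Proof. by rewrite /=; do !case: ifP => _; rewrite /= ?inE ?law_eqs. Qed.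

Lemma jordan_dom_uniq : uniq (law_dom (jordan alpha)).
Proof. by rewrite /= !inE !law_eqs. Qed.

Lemma jordan_op_uniq l m : uniq (law_op (jordan alpha) l m).
Proof. by rewrite /=; do !case: ifP => _; rewrite /= ?inE ?law_eqs. Qed.

(** The Seress lemma: as the fusion law sends [(l, 1)] and [(l, 0)] into [{l}],
    multiplication by an element of A_1(a) + A_0(a) preserves each eigenspace
    of [a], so it commutes with multiplication by [a]. *)
Lemma seress a v y : axis (monster alpha beta) a -> eigen_sum a [:: 1; 0] y ->
  a ** (v ** y) = (a ** v) ** y.
Proof.
move=> aL ay; have [_ _ dec _] := aL.
have : eigen_sum a (law_dom (monster alpha beta)) v by rewrite dec.
apply: (@eigen_sum_min _ _ _ _ [set v | a ** (v ** y) = (a ** v) ** y]).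
  split=> [|k u w] /= => [|Eu Ew]; first by rewrite amul0r [a ** 0]amulC !amul0r.
  by rewrite !(amulDr, amulDl, amulZl, amulZr) Eu Ew.
move=> l lL w lw /=; rewrite lw amulZl; apply: eigen_sum1.
apply: (axis_fusion aL (s := [:: l]) (t := [:: 1; 0])) => //.
- rewrite /fusion_closed; move: lL; rewrite !inE.
  by move=> /or4P[] /eqP->;
    rewrite /= !(inE, eqxx, law_eqs) /= ?(inE, eqxx, law_eqs).
- by move=> m; rewrite inE => /eqP->.
- by move=> m; rewrite !inE => /orP[] ->; rewrite ?orbT.
- by apply: eigen_sum_eigen; rewrite ?inE.
Qed.

Lemma monster_jordan a : (forall v, eigen a beta v -> v = 0) ->
  axis (monster alpha beta) a -> axis (jordan alpha) a.
Proof.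
move=> nobeta aL; have [a0 aa dec _] := aL; split=> //.
  apply/seteqP; split=> // v _.
  have : eigen_sum a ([:: 1; 0; alpha] ++ [:: beta]) v by rewrite dec.
  by move=> /eigen_sum_cat[u [w [au /eigen_sum1/nobeta-> ->]]]; rewrite addr0.
move=> l m v w lL mL lv mw.
apply: (axis_fusion aL (s := [:: l]) (t := [:: m])).
- move: lL mL; rewrite /fusion_closed !inE.
  by move=> /or3P[] /eqP-> /or3P[] /eqP->;
    rewrite /= !(inE, eqxx, law_eqs) /= ?(inE, eqxx, law_eqs).
- exact: jordan_op_uniq.
- move=> k; rewrite inE => /eqP->; move: lL; rewrite !inE.
  by move=> /or3P[] ->; rewrite ?orbT.
- move=> k; rewrite inE => /eqP->; move: mL; rewrite !inE.
  by move=> /or3P[] ->; rewrite ?orbT.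
- by apply: eigen_sum_eigen; rewrite ?inE.
- by apply: eigen_sum_eigen; rewrite ?inE.
Qed.

Hypothesis char2 : 2%N \notin [pchar F].

Lemma two_neq0 : 2%:R != 0 :> F.
Proof. by move: char2; rewrite inE. Qed.

Lemma eq_opp0 v : v = - v -> v = 0.
Proof.
move=> /eqP; rewrite -subr_eq0 opprK -mulr2n -scaler_nat scaler_eq0.
by rewrite (negPf two_neq0) => /eqP.
Qed.

Lemma miyamoto_sign a : axis (monster alpha beta) a ->
  acts_by_sign [:: beta] [:: 1; 0; alpha] a (miyamoto alpha beta a).
Proof. by move=> aL; apply: sign_autP aL monster_graded. Qed.

Lemma miyamoto_fixed a v : axis (monster alpha beta) a ->
  miyamoto alpha beta a v = v -> eigen_sum a [:: 1; 0; alpha] v.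
Proof.
move=> aL; have [tm tp] := miyamoto_sign aL; have [_ _ dec _] := aL.
have : eigen_sum a ([:: 1; 0; alpha] ++ [:: beta]) v by rewrite dec.
move=> /eigen_sum_cat[u [w [au /eigen_sum1 bw ->]]].
rewrite (homD (aut_hom _)) (tm beta w) ?inE //.
have -> : miyamoto alpha beta a u = u.
  case: au => f fE ->.
  have t_hom := aut_hom (miyamoto alpha beta a).
  rewrite (big_morph _ (homD t_hom) (hom0 t_hom)).
  by apply: eq_big_seq => l ls; apply: tp (fE l ls).
by move=> /addrI/esym/eq_opp0->; rewrite addr0.
Qed.

Lemma miyamoto_fixed_beta a v : axis (monster alpha beta) a ->
  miyamoto alpha beta a v = v -> eigen a beta v -> v = 0.
Proof.
move=> /miyamoto_sign[tm _] tv bv; apply: eq_opp0.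
by rewrite -{1}tv (tm beta) ?inE.
Qed.

End Laws.

(** * Pairs of axes of Jordan type *)

(** With the three coefficients packed together, identities in the algebra
    reduce to identities in the field, coefficient by coefficient. *)
Definition comb (F : fieldType) (A : naAlgType F) (x y z : A) (k l m : F) : A :=
  k *: x + l *: y + m *: z.

Section Comb.
Variables (F : fieldType) (A : naAlgType F) (x y z : A).
Local Notation c := (comb x y z).

Lemma combD k l m k' l' m' : c k l m + c k' l' m' = c (k + k') (l + l') (m + m').
Proof. by rewrite /comb !scalerDl addrACA [X in X + _ = _]addrACA. Qed.

Lemma combZ t k l m : t *: c k l m = c (t * k) (t * l) (t * m).
Proof. by rewrite /comb !scalerDr !scalerA. Qed.

Lemma combN k l m : - c k l m = c (- k) (- l) (- m).
Proof. by rewrite -scaleN1r combZ !mulN1r. Qed.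

Lemma comb100 : c 1 0 0 = x.
Proof. by rewrite /comb scale1r !scale0r !addr0. Qed.

Lemma comb010 : c 0 1 0 = y.
Proof. by rewrite /comb scale1r !scale0r add0r addr0. Qed.

Lemma comb001 : c 0 0 1 = z.
Proof. by rewrite /comb scale1r !scale0r !add0r. Qed.

(** An opaque form of [comb x y z]: the vectors [x], [y] and [z] do not occur
    in it, so they can be rewritten everywhere with their coordinates. *)
Lemma comb_abstract : exists c' : F -> F -> F -> A,
  [/\ x = c' 1 0 0, y = c' 0 1 0, z = c' 0 0 1 &
   [/\ forall k l m k' l' m',
         c' k l m + c' k' l' m' = c' (k + k') (l + l') (m + m'),
       forall t k l m, t *: c' k l m = c' (t * k) (t * l) (t * m) &
       forall k l m, - c' k l m = c' (- k) (- l) (- m)]].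
Proof.
exists c; rewrite comb100 comb010 comb001; split=> //.
by split; [exact: combD|exact: combZ|exact: combN].
Qed.

End Comb.

Section JordanTriple.
Variables (F : fieldType) (A : naAlgType F) (eta phi : F) (a b s : A).
Local Notation c := (comb a b s).
Local Notation pi := ((1 - eta) * phi - eta).

(** The multiplication table of the span of two axes [a], [b] and of [s], which
    behaves as [pi] times an identity; [phi] is the coefficient of the projection
    of one axis to the other. *)
Definition jordan_triple : Prop :=
  [/\ a ** a = a, b ** b = b, a ** b = s + eta *: (a + b) &
   [/\ a ** s = pi *: a, b ** s = pi *: b & s ** s = pi *: s]].

Hypothesis triple : jordan_triple.

Lemma combM k l m k' l' m' : c k l m ** c k' l' m' =
  c (k * k' + eta * (k * l' + l * k') + pi * (k * m' + m * k'))
    (l * l' + eta * (k * l' + l * k') + pi * (l * m' + m * l'))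
    ((k * l' + l * k') + pi * (m * m')).
Proof.
have [aa bb ab [as_ bs ss]] := triple.
rewrite /comb !amulDl !amulDr !amulZl !amulZr.
rewrite [b ** a]amulC [s ** a]amulC [s ** b]amulC aa bb ab as_ bs ss.
have [d [-> -> -> [dD dZ dN]]] := comb_abstract a b s.
by rewrite !(dD, dZ, dN); congr (d _ _ _); ring.
Qed.

End JordanTriple.

Section JordanPair.
Variables (F : fieldType) (alpha beta : F).
Hypothesis distinct : uniq [:: 1; 0; alpha; beta].
Variable A : naAlgType F.
Implicit Types (a b : A).

Local Notation M := (monster alpha beta).
Local Notation pi phi := ((1 - alpha) * phi - alpha).

Let a0 : alpha != 0 := alpha_neq0 distinct.

Let a1 : 1 - alpha != 0.
Proof. by rewrite subr_eq0 eq_sym (alpha_neq1 distinct). Qed.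

Let uniq10 : uniq [:: 1; 0 : F].
Proof. by rewrite /= inE oner_eq0. Qed.

Lemma primitive_split a v : primitive_axis M a -> eigen_sum a [:: 1; 0; alpha] v ->
  exists phi v0 ve, [/\ eigen a 0 v0, eigen a alpha ve & v = phi *: a + v0 + ve].
Proof.
move=> [_ prim] [w wE ->].
have : eigen a 1 (w 1) by apply: wE; rewrite inE eqxx.
rewrite prim => -[phi _ phiE]; exists phi, (w 0), (w alpha).
split; try by apply: wE; rewrite !inE eqxx ?orbT.
by rewrite !big_cons big_nil addr0 phiE addrA.
Qed.

(** The alpha-part of [b] cancels in [s = ab - alpha (a + b)], so that [s] lies in
    A_1(a) + A_0(a), and likewise for [b], where the Seress lemma applies. *)
Lemma jordan_s_eq a b phi b0 be :
    a ** a = a -> eigen a 0 b0 -> eigen a alpha be -> b = phi *: a + b0 + be ->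
  a ** b - alpha *: (a + b) = pi phi *: a - alpha *: b0.
Proof.
rewrite /eigen /= scale0r => aa ab0 abe ->.
rewrite !amulDr amulZr aa ab0 abe addr0.
have [d [-> -> -> [dD dZ dN]]] := comb_abstract a b0 be.
by rewrite !(dD, dZ, dN); congr (d _ _ _); ring.
Qed.

Lemma jordan_s a b phi b0 be (s := a ** b - alpha *: (a + b)) :
    a ** a = a -> eigen a 0 b0 -> eigen a alpha be -> b = phi *: a + b0 + be ->
  a ** s = pi phi *: a /\ eigen_sum a [:: 1; 0] s.
Proof.
move=> aa ab0 abe bE; have sE := jordan_s_eq aa ab0 abe bE; rewrite /s {}sE.
split.
  by rewrite amulDr -scaleNr !amulZr aa ab0 scale0r scaler0 addr0.
apply: subspaceB; try exact: eigen_sum_subspace.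
  apply: subspaceZ; first exact: eigen_sum_subspace.
  apply: (@eigen_sum_eigen _ _ _ _ 1) (uniq10) _ _ _; first by rewrite mem_head.
  by rewrite /eigen /= scale1r.
apply: subspaceZ; first exact: eigen_sum_subspace.
by apply: (@eigen_sum_eigen _ _ _ _ 0) (uniq10) _ _ ab0; rewrite !inE eqxx orbT.
Qed.

(** The Seress lemma for [a] and for [b] evaluates [(ab)s] in two ways, hence
    the projection coefficients of the two axes on each other agree. *)
Lemma jordan_pairP a b phi b0 be :
    primitive_axis M a -> primitive_axis M b ->
    eigen a 0 b0 -> eigen a alpha be -> b = phi *: a + b0 + be ->
    eigen_sum b [:: 1; 0; alpha] a ->
  jordan_triple alpha phi a b (a ** b - alpha *: (a + b)).
Proof.
move=> aP bP ab0 abe bE /(primitive_split bP)[psi [a0' [ae [ba0 bae aE]]]].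
have [[aN0 aa _ _] _] := aP; have [[bN0 bb _ _] _] := bP.
have [aL _] := aP; have [bL _] := bP.
set s := a ** b - _.
have [as_ s10a] := jordan_s aa ab0 abe bE; rewrite -/s in as_ s10a.
have [bs s10b] := jordan_s bb ba0 bae aE.
rewrite [b ** a]amulC [b + a]addrC -/s in bs s10b.
have E1 : pi psi *: (a ** b) = (a ** b) ** s.
  by rewrite -(seress distinct b aL s10a) bs amulZr.
have E2 : pi phi *: (a ** b) = (a ** b) ** s.
  by rewrite [a ** b]amulC -(seress distinct a bL s10b) as_ amulZr.
have psiE : psi = phi.
  apply: (mulfI a1); apply: (addIr (- alpha)); apply/eqP; rewrite -subr_eq0.
  have : (pi psi - pi phi) *: (a ** b) == 0 by rewrite scalerBl E1 E2 subrr.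
  rewrite scaler_eq0 => /orP[//|/eqP ab_0].
  have phi0 (u w : A) k u0 ue : primitive_axis M u -> w = k *: u + u0 + ue ->
      eigen u 0 u0 -> eigen u alpha ue -> u ** w = 0 -> k = 0.
    move=> [[uN0 uu _ _] _] wE u00 uee; rewrite wE !amulDr amulZr uu u00 uee.
    rewrite scale0r addr0 => E.
    have [] := @eigen_direct _ _ u [:: 1] [:: alpha] (k *: u) (alpha *: ue).
    - by move: a1; rewrite subr_eq0 /= inE => ->.
    - apply: eigen_sum_eigen; rewrite ?inE //.
      by rewrite /eigen /= amulZr uu scale1r.
    - apply: eigen_sum_eigen; rewrite ?inE //.
      by apply: subspaceZ => //; apply: eigen_subspace.
    - exact: E.
    by move=> /eqP; rewrite scaler_eq0 (negPf uN0) orbF => /eqP.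
  have psi0 : psi = 0 by apply: phi0 bP aE ba0 bae _; rewrite amulC.
  have -> : phi = 0 by apply: phi0 aP bE ab0 abe ab_0.
  by rewrite psi0 subrr.
have abE : a ** b = s + alpha *: (a + b) by rewrite /s subrK.
rewrite psiE in bs; split=> //; split=> //.
rewrite {1}/s amulDl -E2 -scaleNr amulZl amulDl as_ bs abE.
have [d [-> -> -> [dD dZ dN]]] := comb_abstract a b s.
by rewrite !(dD, dZ, dN); congr (d _ _ _); ring.
Qed.

(** The alpha-part of [b] is a combination of [a] and [ab], and [s] multiplies
    both by [pi phi]. *)
Lemma jordan_s_odd a b s phi b0 be :
    jordan_triple alpha phi a b s -> eigen a 0 b0 -> eigen a alpha be ->
    b = phi *: a + b0 + be ->
  alpha *: be = a ** b - phi *: a /\ s ** be = pi phi *: be.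
Proof.
move=> [aa bb ab [as_ bs ss]] ab0 abe bE.
have beE : alpha *: be = a ** b - phi *: a.
  rewrite bE !amulDr amulZr aa ab0 abe scale0r addr0.
  by rewrite addrAC subrr add0r.
split=> //; apply: (scalerI a0); rewrite -amulZr scalerA [alpha * _]mulrC.
rewrite -scalerA beE ab -scaleNr !amulDr !amulZr !amulDr.
rewrite [s ** a]amulC [s ** b]amulC ss as_ bs.
have [d [-> -> -> [dD dZ dN]]] := comb_abstract a b s.
by rewrite !(dD, dZ, dN); congr (d _ _ _); ring.
Qed.

(** Compare the alpha-parts of [b] and of [b ** b]: the even part [u] of [b]
    multiplies the odd part [be] by a scalar [k], and both squares are even,
    so idempotency means [2 k = 1]. *)
Lemma jordan_phi a b phi b0 be (s := a ** b - alpha *: (a + b)) :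
    axis M a -> jordan_triple alpha phi a b s ->
    eigen a 0 b0 -> eigen a alpha be -> b = phi *: a + b0 + be -> be != 0 ->
  (alpha * 2%:R - 1) * (phi * 2%:R - alpha) = 0.
Proof.
move=> aL triple ab0 abe bE beN0.
have [aa bb _ _] := triple; have [_ sbe] := jordan_s_odd triple ab0 abe bE.
have sE : s = pi phi *: a - alpha *: b0 := jordan_s_eq aa ab0 abe bE.
clearbody s; pose u := phi *: a + b0; have {}bE : b = u + be by [].
have b0E : b0 = alpha^-1 *: (pi phi *: a - s).
  by rewrite sE opprB addrC subrK scalerK.
pose k := phi * alpha + (pi phi * alpha - pi phi) / alpha.
have ube : u ** be = k *: be.
  rewrite /u b0E amulDl !amulZl amulDl -[- s]scaleN1r !amulZl sbe abe.
  by rewrite !(scalerA, scalerDr) -!scalerDl /k; congr (_ *: _); field.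
have u10 : eigen_sum a [:: 1; 0] u.
  apply: subspaceD; first exact: eigen_sum_subspace.
    apply: subspaceZ; first exact: eigen_sum_subspace.
    apply: (@eigen_sum_eigen _ _ _ _ 1) (uniq10) _ _ _; first by rewrite mem_head.
    by rewrite /eigen /= scale1r.
  by apply: (@eigen_sum_eigen _ _ _ _ 0) (uniq10) _ _ ab0; rewrite !inE eqxx orbT.
have be_odd : eigen_sum a [:: alpha] be.
  by apply: eigen_sum_eigen; rewrite ?inE.
have dom1 : {subset [:: 1; 0] <= law_dom M}.
  by move=> l; rewrite !inE => /orP[] ->; rewrite ?orbT.
have dom2 : {subset [:: alpha] <= law_dom M}.
  by move=> l; rewrite !inE => ->; rewrite !orbT.
have := @jordan_graded _ _ _ distinct => /and5P[_ dom_uniq _ _ _].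
have kE : k = phi * alpha + (pi phi * alpha - pi phi) / alpha by [].
clearbody u k.
have [_ E] : (u ** u + be ** be - u = 0) /\ (k * 2%:R - 1) *: be = 0.
  apply: (eigen_direct dom_uniq).
  - apply: subspaceB (u10); first exact: eigen_sum_subspace.
    apply: subspaceD; first exact: eigen_sum_subspace.
      exact: (axis_fusion aL (fusion10 distinct) uniq10 dom1 dom1 u10 u10).
    exact: (axis_fusion aL (fusion_alpha distinct) uniq10 dom2 dom2 be_odd be_odd).
  - exact: (subspaceZ (eigen_sum_subspace a _)).
  have bbE : b ** b = u ** u + be ** be + (k * 2%:R) *: be.
    rewrite bE amulDl !amulDr [be ** u]amulC ube.
    have [d [-> -> -> [dD dZ dN]]] := comb_abstract (u ** u) (be ** be) be.
    by rewrite !(dD, dZ, dN); congr (d _ _ _); ring.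
  rewrite -[RHS]oppr0 -(subrr b) -{2}bb bbE bE.
  have [d [-> -> -> [dD dZ dN]]] := comb_abstract (u ** u + be ** be) u be.
  by rewrite !(dD, dZ, dN); congr (d _ _ _); ring.
move: E => /eqP; rewrite scaler_eq0 (negPf beN0) orbF => /eqP E.
rewrite kE in E; have <- : alpha * 0 = 0 by rewrite mulr0.
by rewrite -E; field.
Qed.

(** When [pi phi] is nonzero, the 0-part [b0] of [b] does not vanish: otherwise
    [s] would be [pi phi *: a], which acts on the alpha-part of [b] as
    [alpha * pi phi] and not as [pi phi]. So [a], [b0] and [be] are
    independent. *)
Lemma jordan_independent a b phi b0 be (s := a ** b - alpha *: (a + b)) k l m :
    axis M a -> jordan_triple alpha phi a b s ->
    eigen a 0 b0 -> eigen a alpha be -> b = phi *: a + b0 + be -> be != 0 ->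
    pi phi != 0 ->
  comb a b s k l m = 0 -> [/\ k = 0, l = 0 & m = 0].
Proof.
move=> aL triple ab0 abe bE beN0 piN0.
have [aN0 aa _ _] := aL.
have [_ sbe] := jordan_s_odd triple ab0 abe bE.
have sE : s = pi phi *: a - alpha *: b0 := jordan_s_eq aa ab0 abe bE.
have b0N0 : b0 != 0.
  apply/eqP => b00; move: sbe => /eqP.
  rewrite sE b00 scaler0 subr0 amulZl abe scalerA -subr_eq0 -scalerBl.
  rewrite scaler_eq0 (negPf beN0) orbF -{2}[pi phi]mulr1 -mulrBr mulf_eq0.
  by rewrite (negPf piN0) -oppr_eq0 opprB (negPf a1).
pose k' := k + l * phi + m * pi phi; pose l' := l - m * alpha.
have -> : comb a b s k l m = k' *: a + l' *: b0 + l *: be.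
  rewrite /comb sE bE /k' /l'.
  have [d [-> -> -> [dD dZ dN]]] := comb_abstract a b0 be.
  by rewrite !(dD, dZ, dN); congr (d _ _ _); ring.
move=> E; have sub l0 := eigen_subspace a l0.
have a1E : eigen a 1 a by rewrite /eigen /= scale1r.
have dom_uniq : uniq ([:: 1; 0] ++ [:: alpha]) := jordan_dom_uniq distinct.
have [E1 /eqP] : k' *: a + l' *: b0 = 0 /\ l *: be = 0.
  apply: (eigen_direct dom_uniq _ _ E); last first.
    by apply: eigen_sum_eigen; rewrite ?inE //; apply: subspaceZ.
  apply: subspaceD; first exact: eigen_sum_subspace.
    apply: (@eigen_sum_eigen _ _ _ _ 1); rewrite ?mem_head //.
    exact: subspaceZ.
  apply: (@eigen_sum_eigen _ _ _ _ 0); rewrite ?inE ?eqxx ?orbT //.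
  exact: subspaceZ.
rewrite scaler_eq0 (negPf beN0) orbF => /eqP l0.
have [] : k' *: a = 0 /\ l' *: b0 = 0.
  apply: (@eigen_direct _ _ a [:: 1] [:: 0] _ _ _ _ _ E1) => //.
    by apply: eigen_sum_eigen; rewrite ?inE //; apply: subspaceZ.
  by apply: eigen_sum_eigen; rewrite ?inE //; apply: subspaceZ.
move=> /eqP; rewrite scaler_eq0 (negPf aN0) orbF => /eqP k0.
move=> /eqP; rewrite scaler_eq0 (negPf b0N0) orbF /l' l0 sub0r oppr_eq0.
rewrite mulf_eq0 (negPf a0) orbF => /eqP m0.
by split=> //; move: k0; rewrite /k' l0 m0 !mul0r !addr0.
Qed.

End JordanPair.

Section SpinAlgebras.
Variables (F : fieldType) (A : naAlgType F).
Hypothesis char2 : 2%N \notin [pchar F].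

Let twoN0 : 2%:R != 0 :> F := two_neq0 char2.

(** If [x = m *: y], then idempotency forces [m * m = m]. *)
Lemma idempotents_independent (x y : A) k l : x != 0 -> y != 0 -> x != y ->
  x ** x = x -> y ** y = y -> k *: x + l *: y = 0 -> k = 0 /\ l = 0.
Proof.
move=> xN0 yN0 xy xx yy E.
have [k0|kN0] := eqVneq k 0.
  split=> //; move: E; rewrite k0 scale0r add0r => /eqP.
  by rewrite scaler_eq0 (negPf yN0) orbF => /eqP.
pose m := - (l / k); have xE : x = m *: y.
  apply: (scalerI kN0); rewrite scalerA mulrN mulrCA mulfV // mulr1.
  by apply/eqP; rewrite scaleNr -subr_eq0 opprK E.
have : (m * (m - 1)) *: y == 0.
  rewrite mulrBr mulr1 scalerBl -xE subr_eq0; apply/eqP.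
  by rewrite -[RHS]xx xE amulZl amulZr yy scalerA.
rewrite scaler_eq0 (negPf yN0) orbF mulf_eq0 subr_eq0 => /orP[] /eqP m0.
  by move: xN0; rewrite xE m0 scale0r eqxx.
by move: xy; rewrite xE m0 scale1r eqxx.
Qed.

Section TwoIdempotents.
Variables (x y : A) (xN0 : x != 0) (yN0 : y != 0) (xNy : x != y).
Hypotheses (xx : x ** x = x) (yy : y ** y = y).

Let span (d : F * F) : A := d.1 *: x + d.2 *: y.

Let span_linear k (d e : F * F) :
  span (k * d.1 + e.1, k * d.2 + e.2) = k *: span d + span e.
Proof. by rewrite /span /= !scalerDl scalerDr !scalerA addrACA. Qed.

Let span_gen d : gen_set [set x; y] (span d).
Proof.
have Y := gen_subspace [set x; y].
apply: (subspaceD Y); apply: (subspaceZ Y); first exact: gen_set_fst.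
exact: gen_set_snd.
Qed.

Let span_surj z : [set x; y] z -> exists d, span d = z.
Proof.
by case=> ->; [exists (1, 0)|exists (0, 1)];
  rewrite /span /= scale1r scale0r ?addr0 ?add0r.
Qed.

Let span_inj : injective span.
Proof.
move=> [k l] [k' l'] /eqP; rewrite -subr_eq0 /span /= opprD addrACA -!scalerBl.
move=> /eqP/(idempotents_independent xN0 yN0 xNy xx yy)[/eqP + /eqP].
by rewrite !subr_eq0 => /eqP-> /eqP->.
Qed.

Lemma gen2_2B : x ** y = 0 -> (gen_alg [set x; y] : naAlgType F) ~= alg2B F.
Proof.
move=> xy; apply: alg_isomorphic_sym.
have [] := @corestrict_iso F A (alg2B F) span [set x; y] _ span_inj span_gen span_surj.
  split=> [k d e|d e]; first exact: (span_linear k d e).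
  case: d e => [k l] [k' l']; rewrite /span /=.
  rewrite !(amulDl, amulDr, amulZl, amulZr) [y ** x]amulC xx yy xy.
  by rewrite !scaler0 addr0 add0r !scalerA [k' * k]mulrC [l' * l]mulrC.
by move=> h hP _; exists h.
Qed.

Lemma gen2_spin2o : x ** y = 2%:R^-1 *: (x + y) ->
  (gen_alg [set x; y] : naAlgType F) ~= spin2o F.
Proof.
move=> xy; apply: alg_isomorphic_sym.
have [] := @corestrict_iso F A (spin2o F) span [set x; y] _ span_inj span_gen span_surj.
  split=> [k d e|d e]; first exact: (span_linear k d e).
  case: d e => [k l] [k' l']; rewrite /span /=.
  rewrite !(amulDl, amulDr, amulZl, amulZr) [y ** x]amulC xx yy xy.
  have [d [-> -> _ [dD dZ dN]]] := comb_abstract x y 0.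
  by rewrite !(dD, dZ, dN); congr (d _ _ _); ring.
by move=> h hP _; exists h.
Qed.

End TwoIdempotents.

Section JordanHalf.
Variables (phi delta : F) (a b s : A).
Hypothesis deltaE : delta = phi * 4%:R - 2%:R.
Hypothesis triple : jordan_triple 2%:R^-1 phi a b s.
Hypothesis phi1 : phi != 1.
Hypothesis indep : forall k l m, comb a b s k l m = 0 -> [/\ k = 0, l = 0 & m = 0].

(** The identity goes to the multiple [2 / (phi - 1)] of [s], which is an identity
    because [pi = (phi - 1) / 2]; the basis vectors [u] and [v] go to [2 a - 1]
    and [2 b - 1], so that the axes [(1 + u) / 2] and [(1 + v) / 2] go to [a]
    and [b]. *)
Definition spin_map (d : spin delta) : A :=
  comb a b s (2%:R * d.2 0 0) (2%:R * d.2 0 1)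
    (2%:R * (d.1 - d.2 0 0 - d.2 0 1) / (phi - 1)).

Lemma spin_iso : exists2 h : spin delta -> gen_alg [set a; b],
  alg_iso h & forall d, gen_val (h d) = spin_map d.
Proof.
have phiN : phi - 1 != 0 by rewrite subr_eq0.
apply: corestrict_iso.
- split=> [k [r w] [t z]|[r w] [t z]]; rewrite /spin_map /=.
    (* [field] sees the operations of [F], not those of the module [F^o]. *)
    have -> : k *: r + t = k * r + t :> F by [].
    by rewrite combZ combD !mxE; congr (comb _ _ _ _ _ _); field.
  rewrite (combM triple) /spin_form !mxE /= deltaE; congr (comb _ _ _ _ _ _); field;
    by rewrite phiN twoN0.
- move=> [r w] [t z] /eqP; rewrite -subr_eq0 => /eqP.
  rewrite /spin_map combN combD /= => /indep[/eqP + /eqP].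
  rewrite -!mulrBr !mulf_eq0 (negPf twoN0) /= !subr_eq0 => /eqP w0 /eqP w1 /eqP.
  rewrite -mulrBl -mulrBr !mulf_eq0 (negPf twoN0) invr_eq0 (negPf phiN) orbF /=.
  rewrite w0 w1 subr_eq0 => /eqP/addIr/addIr->; congr (_, _).
  apply/rowP => i; have [->|->] : i = 0 \/ i = 1; [|exact: w0|exact: w1].
  by case: i => [[|[|]]] // i2; [left|right]; apply: val_inj.
- have Y := gen_subspace [set a; b].
  have Ya : gen_set [set a; b] a by apply: gen_set_fst.
  have Yb : gen_set [set a; b] b by apply: gen_set_snd.
  have Ys : gen_set [set a; b] s.
    have [_ _ ab _] := triple.
    rewrite -(addrK (2%:R^-1 *: (a + b)) s) -ab; apply: (subspaceB Y).
      exact: gen_setM.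
    by apply: (subspaceZ Y); apply: (subspaceD Y).
  by move=> d; do 2?apply: (subspaceD Y); apply: (subspaceZ Y).
pose axis_of (k l : F) : spin delta :=
  (2%:R^-1, \row_i (if i == 0 then k else l)).
move=> y [->|->].
  exists (axis_of 2%:R^-1 0); rewrite /spin_map /= !mxE /= -[RHS](comb100 a b s).
  by congr (comb _ _ _ _ _ _); field; rewrite ?phiN ?twoN0.
exists (axis_of 0 2%:R^-1); rewrite /spin_map /= !mxE /= -[RHS](comb010 a b s).
by congr (comb _ _ _ _ _ _); field; rewrite ?phiN ?twoN0.
Qed.

End JordanHalf.

(** Here [b'] is the image of [b] under the involution that changes the sign of
    its eta-part for [a]. Modulo [b], the vectors [b'] and [b ** b'] are nonzero
    multiples of [(phi - eta) a - s] and [eta a + s], whose sum is [phi a]. *)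
Lemma opposite_gen (eta phi : F) (a b s : A)
    (b' := comb a b s (- (2%:R * (eta - phi) / eta)) (-1) (- (2%:R / eta))) :
    jordan_triple eta phi a b s -> eta != 0 -> phi != 0 -> eta - phi != 0 ->
  gen_set [set b; b'] a.
Proof.
move=> triple etaN0 phiN0 dN0.
(* With weights [y] and [z] the terms in [s] cancel; [x] then cancels those in [b]. *)
pose y := eta / (2%:R * phi); pose z := - (eta / (2%:R * phi * (eta - phi))).
pose x := y + z * (1 + 2%:R * (eta - phi) + 2%:R * ((1 - eta) * phi - eta) / eta).
have -> : a = x *: b + y *: b' + z *: (b ** b').
  rewrite -[LHS](comb100 a b s) -[X in x *: X](comb010 a b s).
  rewrite -[X in X ** _](comb010 a b s) (combM triple).
  rewrite !combZ !combD /x /y /z; congr (comb _ _ _ _ _ _); field;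
    by rewrite ?etaN0 ?phiN0 ?dN0 ?twoN0.
have Y := gen_subspace [set b; b'].
have Yb : gen_set [set b; b'] b by apply: gen_set_fst.
have Yb' : gen_set [set b; b'] b' by apply: gen_set_snd.
by do 2?apply: (subspaceD Y); apply: (subspaceZ Y) => //; apply: gen_setM.
Qed.

Variables alpha beta : F.
Hypothesis distinct : uniq [:: 1; 0; alpha; beta].

(** Write [phi] for the coefficient of the projection of [b] to [a]. By
    [jordan_phi] either [phi = alpha / 2] or [alpha = 1 / 2]; in the first case
    [opposite_gen] recovers [a] from [b] and [g b], and in the second it
    fails only for [phi = 0] and [phi = 1 / 2], which lead to S(4 phi - 2), that is
    S(-2) and S(0). *)
Lemma jordan_pair_trichotomy (a b : A) (g : aut A) :
    primitive_axis (monster alpha beta) a ->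
    primitive_axis (monster alpha beta) b ->
    eigen_sum a [:: 1; 0; alpha] b -> eigen_sum b [:: 1; 0; alpha] a ->
    acts_by_sign [:: alpha] [:: 1; 0] a g -> g b <> b ->
  [\/ gen_set [set b; g b] a,
      [/\ alpha = 2%:R^-1,
          (gen_alg [set a; b] : naAlgType F) ~= spin (-2%:R : F) &
          (gen_alg [set b; g b] : naAlgType F) ~= spin2o F] |
      [/\ alpha = 2%:R^-1,
          exists2 f : spin (0 : F) -> gen_alg [set a; b], alg_iso f &
            exists x y, [/\ spin_opposite x y, f x = b :> A &
                            f y = g b :> A] &
          (gen_alg [set b; g b] : naAlgType F) ~= alg2B F]].
Proof.
move=> aP bP ab ba [gm gp] gb.
have [phi [b0 [be [ab0 abe bE]]]] := primitive_split aP ab.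
have triple := jordan_pairP distinct aP bP ab0 abe bE ba.
have [aL _] := aP; have [[bN0 bb _ _] _] := bP; have [_ aa _ _] := aL.
have alphaN0 := alpha_neq0 distinct; have alphaN1 := alpha_neq1 distinct.
have gbE : g b = b - 2%:R *: be.
  have g_hom := aut_hom g.
  rewrite {1}bE !(homD g_hom) (homZ g_hom) (gm alpha be) ?inE //.
  rewrite (gp 1 a) ?inE ?eqxx //; last by rewrite /eigen /= scale1r.
  rewrite (gp 0 b0) ?inE ?eqxx ?orbT // {1}bE.
  have [d [-> -> -> [dD dZ dN]]] := comb_abstract a b0 be.
  by rewrite !(dD, dZ, dN); congr (d _ _ _); ring.
have beN0 : be != 0 by apply/eqP => be0; apply: gb; rewrite gbE be0 scaler0 subr0.
have phiE := jordan_phi distinct aL triple ab0 abe bE beN0.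
have indep := jordan_independent distinct aL triple ab0 abe bE beN0.
have [beE _] := jordan_s_odd distinct triple ab0 abe bE.
set s := a ** b - _ in triple indep beE.
have {}gbE : g b =
    comb a b s (- (2%:R * (alpha - phi) / alpha)) (-1) (- (2%:R / alpha)).
  have [_ _ abE _] := triple.
  rewrite gbE -(scalerK alphaN0 be) beE abE /comb.
  have [d [-> -> -> [dD dZ dN]]] := comb_abstract a b s.
  by rewrite !(dD, dZ, dN); congr (d _ _ _); field.
clearbody s; have gbb : g b ** g b = g b by rewrite -(homM (aut_hom g)) bb.
have gbN0 : g b != 0.
  apply: contraNneq bN0 => gb0; apply/eqP/(@aut_inj _ _ g).
  by rewrite gb0 (hom0 (aut_hom g)).
have bNgb : b != g b by apply/eqP => /esym.
have [half|nothalf] := eqVneq alpha 2%:R^-1; last first.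
  apply: Or31; rewrite gbE.
  have phiA : phi * 2%:R = alpha.
    apply/eqP; rewrite -subr_eq0; move/eqP: phiE; rewrite mulf_eq0 => /orP[|//].
    move=> /eqP/subr0_eq E; case/eqP: nothalf.
    by apply: (mulIf twoN0); rewrite E mulVf.
  have phiN0 : phi != 0.
    by apply: contraNneq alphaN0 => phi0; rewrite -phiA phi0 mul0r.
  apply: opposite_gen => //.
  by rewrite -phiA mulr_natr mulr2n addrK.
have [phi0|phiN0] := eqVneq phi 0.
  apply: Or32; split=> //.
    have [||||h hP _] := @spin_iso phi (- 2%:R) a b s.
    - by rewrite phi0; ring.
    - by rewrite -half.
    - by rewrite phi0 eq_sym oner_eq0.
    - move=> k l m; apply: indep; rewrite phi0 mulr0 sub0r oppr_eq0 //.
    by apply: alg_isomorphic_sym; exists h.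
  apply: gen2_spin2o => //.
  rewrite gbE -[X in X ** _](comb010 a b s) (combM triple).
  rewrite -[X in _ *: (X + _)](comb010 a b s) combD combZ.
  by rewrite phi0 half; congr (comb _ _ _ _ _ _); field;
    rewrite ?twoN0 ?oner_neq0.
have [phiA|phiNA] := eqVneq (alpha - phi) 0; last first.
  by apply: Or31; rewrite gbE; apply: opposite_gen.
have {}phiA : phi = 2%:R^-1 by rewrite -half; apply/esym/eqP; rewrite -subr_eq0 phiA.
apply: Or33; split=> //.
  have [||||h hP hE] := @spin_iso phi 0 a b s.
  - by rewrite phiA; field.
  - by rewrite -half.
  - by rewrite phiA -half.
  - move=> k l m; apply: indep; rewrite phiA half.
    have -> : (1 - 2%:R^-1) * 2%:R^-1 - 2%:R^-1 = - (2%:R^-1 * 2%:R^-1) :> F.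
      by ring.
    by rewrite oppr_eq0 mulf_neq0 ?invr_neq0.
  exists h => //.
  pose w : 'rV[F]_2 := \row_i (if i == 0 then 0 else 1).
  exists (2%:R^-1 *: ((1, w) : spin 0)), (2%:R^-1 *: ((1, - w) : spin 0)).
  have phi1 : phi - 1 != 0 by rewrite subr_eq0 phiA -half.
  have half1 : 2%:R^-1 *: (1 : F^o) = 2%:R^-1 by apply: mulr1.
  split.
  - by exists w; split=> //; rewrite /spin_form !mxE /=; ring.
  - rewrite hE /spin_map !mxE /= half1 -[RHS](comb010 a b s).
    by congr (comb _ _ _ _ _ _); field; rewrite ?phi1 ?twoN0.
  - rewrite hE /spin_map !mxE /= half1 gbE phiA half.
    by congr (comb _ _ _ _ _ _); field; rewrite ?oppr_eq0 ?twoN0 ?oner_neq0.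
apply: gen2_2B => //.
rewrite gbE -[X in X ** _](comb010 a b s) (combM triple).
rewrite phiA half -[RHS](subrr (comb a b s 0 0 0)) combN combD.
by congr (comb _ _ _ _ _ _); field; rewrite ?twoN0 ?oner_neq0.
Qed.

End SpinAlgebras.

(** * Odd polygons *)

Section OddCyclic.
Variables (n : nat).
Hypotheses (n_gt1 : (1 < n)%N) (n_odd : odd n).

Lemma Zp_halve : exists h : 'Z_n, h *+ 2 = 1.
Proof.
exists (n.+1./2)%:R; rewrite mulr2n -natrD addnn.
have -> : n.+1./2.*2 = n.+1 by rewrite -[RHS]odd_double_half /= n_odd.
by rewrite -natr1 pchar_Zp // add0r.
Qed.

Lemma Zp_double_inj : injective (fun i : 'Z_n => i *+ 2).
Proof.
have [h h2] := Zp_halve => i j /= ij.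
by rewrite -[i]mulr1 -[j]mulr1 -h2 !mulrnAr -!mulrnAl ij.
Qed.

(** The composite of the reflections in two adjacent vertices is the rotation
    by 2, and 2 is invertible modulo an odd [n]. *)
Lemma Zp_reflections_transitive (P : 'Z_n -> Prop) i j :
    (forall k, P k -> P (0 *+ 2 - k)) -> (forall k, P k -> P (1 *+ 2 - k)) ->
  P i -> P j.
Proof.
move=> P0 P1 Pi; have [h h2] := Zp_halve.
have P2 m : P (i + 2%:R * m%:R).
  elim: m => [|m IHm]; first by rewrite mulr0 addr0.
  have := P1 _ (P0 _ IHm); rewrite mul0rn sub0r opprK addrCA.
  by rewrite -[m.+1]add1n natrD mulrDr mulr1.
have := P2 (h * (j - i) : 'Z_n).
by rewrite natr_Zp mulrA mulr_natl h2 mul1r addrC subrK.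
Qed.

(** Paired with the parity of [k], this is the Chinese remainder isomorphism
    of Z/2n with Z/2 x Z/n. *)
Definition Zp_residue (k : 'Z_(n.*2)) : 'Z_n := (k : nat)%:R.

Let double_gt1 : (1 < n.*2)%N.
Proof. by rewrite -addnn; apply: leq_trans n_gt1 (leq_addr _ _). Qed.

Lemma Zp_parity_nat m : odd (m%:R : 'Z_(n.*2)) = odd m.
Proof. by rewrite val_Zp_nat // odd_mod // odd_double. Qed.

Lemma Zp_residue_nat m : Zp_residue m%:R = m%:R.
Proof.
rewrite /Zp_residue val_Zp_nat //; apply: val_inj.
by rewrite /= !val_Zp_nat // modn_dvdm // -muln2 dvdn_mulr.
Qed.

Lemma Zp_parityD (k l : 'Z_(n.*2)) : odd (k + l)%R = odd k (+) odd l.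
Proof. by rewrite -{1}(natr_Zp k) -{1}(natr_Zp l) -natrD Zp_parity_nat oddD. Qed.

Lemma Zp_residueD : {morph Zp_residue : k l / k + l}.
Proof.
move=> k l; rewrite -{1}(natr_Zp k) -{1}(natr_Zp l) -natrD Zp_residue_nat.
by rewrite natrD.
Qed.

Lemma Zp_parity_half (k : 'Z_(n.*2)) : odd (k + n%:R)%R = ~~ odd k.
Proof. by rewrite Zp_parityD Zp_parity_nat n_odd addbT. Qed.

Lemma Zp_residue_half (k : 'Z_(n.*2)) : Zp_residue (k + n%:R) = Zp_residue k.
Proof. by rewrite Zp_residueD Zp_residue_nat pchar_Zp // addr0. Qed.

Lemma Zp_parity_refl (i k : 'Z_(n.*2)) : odd (i *+ 2 - k)%R = odd k.
Proof.
have := Zp_parityD (i *+ 2 - k) k; rewrite subrK mulr2n Zp_parityD addbb.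
by case: (odd k); case: (odd _).
Qed.

Lemma Zp_residue_refl (i k : 'Z_(n.*2)) :
  Zp_residue (i *+ 2 - k) = Zp_residue i *+ 2 - Zp_residue k.
Proof.
apply: (addIr (Zp_residue k)); rewrite -Zp_residueD !subrK !mulr2n.
exact: Zp_residueD.
Qed.

Lemma Zp_crt_inj (k l : 'Z_(n.*2)) : odd k = odd l ->
  Zp_residue k = Zp_residue l -> k = l.
Proof.
move=> kl rkl; apply: subr0_eq; set d := k - l.
have dE : d + l = k by rewrite subrK.
have d_even : ~~ odd d.
  by have := Zp_parityD d l; rewrite dE kl; case: (odd d); case: (odd l).
have d_mod : Zp_residue d = 0.
  by apply: (addIr (Zp_residue l)); rewrite -Zp_residueD dE add0r.
have n_d : (n %| d)%N.
  have := congr1 val d_mod; rewrite /Zp_residue /= val_Zp_nat //.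
  by rewrite /dvdn => ->.
have dvd_double (m : nat) : ~~ odd m -> (n %| m)%N -> (n.*2 %| m)%N.
  by move=> m_even n_m; rewrite -muln2 Gauss_dvd ?coprimen2 // n_m dvdn2.
have d_lt : (d < n.*2)%N by apply: leq_trans (ltn_ord d) _; rewrite Zp_cast.
have [d0|d_gt0] := posnP d; first exact: val_inj.
by have := dvdn_leq d_gt0 (dvd_double _ d_even n_d); rewrite leqNgt d_lt.
Qed.

Lemma Zp_crt_surj (e : bool) (i : 'Z_n) :
  exists2 k : 'Z_(n.*2), odd k = e & Zp_residue k = i.
Proof.
(* Adding [n] corrects the parity of a representative, if necessary. *)
exists (i + n * (odd i (+) e))%:R; last first.
  by rewrite Zp_residue_nat natrD natrM pchar_Zp // mul0r addr0 natr_Zp.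
rewrite Zp_parity_nat oddD oddM n_odd /= oddb; by case: (odd i); case: e.
Qed.

End OddCyclic.

(** Used with [Y] an explicit axet on Z/2n: maps out of it are defined by
    formulas, whereas maps into it need a choice. *)
Lemma axet_isomorphic_inv (X Y : axet) (h : axT Y -> axT X) (y0 : axT Y) :
    set_bij (axX Y) (axX X) h ->
    (forall x y, axX Y x -> axX Y y ->
       h (axact y (axtau x)) = axact (h y) (axtau (h x))) ->
  axet_isomorphic X Y.
Proof.
move=> [hfun hinj hsurj] hmorph.
have [f fP] : {f : axT X -> axT Y &
    forall x, axX X x -> axX Y (f x) /\ h (f x) = x}.
  apply: (@choice _ _ (fun x y => axX X x -> axX Y y /\ h y = x)) => x.
  have [/hsurj[y Yy hy]|nXx] := pselect (axX X x); first by exists y.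
  by exists y0.
have fK y : axX Y y -> f (h y) = y.
  move=> Yy; have [Yf E] := fP _ (hfun _ Yy).
  by apply: hinj E; rewrite inE.
exists f; split; split.
- by move=> x /fP[].
- move=> x y Xx Xy; have [Yx hx] := fP _ Xx; have [Yy hy] := fP _ Xy.
  rewrite -{1}hx -{1}hy -hmorph // fK //.
  by apply: (axet_stable (axP Y)) => //; apply: (axet_tau_in (axP Y)).
- by move=> x /fP[].
- move=> x y; rewrite !inE => /fP[_ hx] /fP[_ hy] E.
  by rewrite -hx E hy.
- by move=> y Yy; exists (h y); [apply: hfun|apply: fK].
Qed.

(** * Axial algebras on the axet X_1(1 + n) *)

Section Pairs.
Variables (F : fieldType) (alpha beta : F).
Hypothesis distinct : uniq [:: 1; 0; alpha; beta].
Variable A : naAlgType F.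
Implicit Types (x y : A) (g : aut A).

Local Notation M := (monster alpha beta).
Local Notation tau := (miyamoto alpha beta).

Lemma aut_fix_gen g (Y : set A) : (forall y, Y y -> g y = y) ->
  forall v, gen_set Y v -> g v = v.
Proof.
move=> gY; apply: gen_set_min => //; have g_hom := aut_hom g.
split=> /= [|k u v Eu Ev|u v Eu Ev]; first exact: hom0.
  by rewrite (homD g_hom) (homZ g_hom) Eu Ev.
by rewrite (homM g_hom) Eu Ev.
Qed.

Lemma axis_eigen1 L x : axis L x -> eigen x 1 x.
Proof. by case=> _ xx _ _; rewrite /eigen /= scale1r. Qed.

(** An axis absorbed by a primitive axis [y] lies on the line of [y], which contains
    a single nonzero idempotent. *)
Lemma primitive_absorb L x y : axis L x -> primitive_axis L y ->
  x ** y = x -> x = y.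
Proof.
move=> [x0 xx _ _] [[_ yy _ _] prim] xy.
have : eigen y 1 x by rewrite /eigen /= amulC xy scale1r.
rewrite prim => -[k _ kx]; have xk : x = k *: x.
  by rewrite -{2}xy -amulZr kx xx.
suff k1 : k = 1 by rewrite -kx k1 scale1r.
apply/eqP; rewrite -subr_eq0; have : (k - 1) *: x == 0.
  by rewrite scalerBl scale1r -xk subrr.
by rewrite scaler_eq0 (negPf x0) orbF.
Qed.

Lemma gen12_generate x y : gen_set [set gen1 x y; gen2 x y] = setT.
Proof.
apply: gen_alg_gen => _ [->|->]; first by exists (gen1 x y); [left|].
by exists (gen2 x y); [right|].
Qed.

Lemma two_gen_pair x y : primitive_axis M x -> primitive_axis M y ->
  two_gen M (gen1 x y) (gen2 x y).
Proof.
have op_uniq := @monster_op_uniq _ _ _ distinct.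
move=> xP yP; split; last exact: gen12_generate.
  exact: (@restrict_primitive_axis _ _ _ M (gen1 x y) distinct op_uniq xP).
exact: (@restrict_primitive_axis _ _ _ M (gen2 x y) distinct op_uniq yP).
Qed.

Lemma symmetric_pair x y g : primitive_axis M x -> primitive_axis M y ->
    (g * g = 1)%g -> g x = y -> g y = x -> x <> y ->
  symmetric_alg alpha beta (gen1 x y) (gen2 x y).
Proof.
move=> xP yP gg gx gy xy; split; first exact: two_gen_pair.
have [|h hE] := @restrict_aut _ _ [set x; y] g gg.
  by move=> _ [->|->]; rewrite ?gx ?gy; [apply: gen_set_snd|apply: gen_set_fst].
have h1 : h (gen1 x y) = gen2 x y by apply: gen_val_inj; rewrite hE.
have h2 : h (gen2 x y) = gen1 x y by apply: gen_val_inj; rewrite hE.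
exists h; split=> // [h1E|].
  by apply: xy; move: h1; rewrite h1E => /(congr1 (@gen_val _ _ _)).
by apply: autE => v; apply: gen_val_inj; rewrite autMg !hE -autMg gg.
Qed.

(** Eigenvectors in the subalgebra are eigenvectors in [A], so both involutions
    act on them by the same signs. *)
Lemma miyamoto_restrict (Y : set A) (x v : gen_alg Y) : axis M (gen_val x) ->
  gen_val (tau x v) = tau (gen_val x) (gen_val v).
Proof.
move=> xL; have graded := monster_graded distinct.
have [|h hE] := @restrict_aut _ _ Y _ (sign_aut2 xL graded).
  move=> y Yy; apply: (sign_aut_stable xL graded (gen_set_subalgebra Y)).
    exact: gen_valE.
  exact: sub_gen_set.
have xL' := @restrict_axis _ _ _ M x distinct (monster_op_uniq distinct) xL.
have [_ _ dec _] := xL'.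
suff -> : tau x = h by rewrite hE.
apply: (@acts_by_sign_uniq _ _ [:: beta] [:: 1; 0; alpha] x _ _ dec).
  exact: (miyamoto_sign distinct xL').
exact: acts_by_sign_restrict hE (miyamoto_sign distinct xL).
Qed.

Lemma aut_primitive_axis L g x : primitive_axis L x -> primitive_axis L (g x).
Proof.
have g_hom := aut_hom g; have gV_hom := aut_hom g^-1%g.
have g_eigen l v : eigen (g x) l v -> eigen x l (g^-1%g v).
  by move=> /(hom_eigen gV_hom); rewrite autK.
have g_sum (s : seq F) v : eigen_sum x s v -> eigen_sum (g x) s (g v).
  case=> w wE ->; exists (g \o w) => [l ls|].
    exact: hom_eigen g_hom _ _ _ (wE l ls).
  by rewrite (big_morph _ (homD g_hom) (hom0 g_hom)).
move=> [[x0 xx dec fus] prim]; split; first split.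
- apply: contraNneq x0 => gx; apply/eqP/(@aut_inj _ _ g).
  by rewrite gx hom0.
- by rewrite -(homM g_hom) xx.
- apply/seteqP; split=> // v _; rewrite -[v](autVK g); apply: g_sum.
  by rewrite dec.
- move=> l m v w lL mL /g_eigen lv /g_eigen mw.
  rewrite -[v ** w](autVK g) (homM gV_hom); apply: g_sum; exact: fus lv mw.
apply/seteqP; split=> [v /g_eigen|_ [k _ <-]].
  rewrite prim => -[k _ E]; exists k => //.
  by rewrite -(homZ g_hom) E autVK.
by rewrite /eigen /= amulZr -(homM g_hom) xx scale1r.
Qed.

End Pairs.

Lemma aut_stab_subgroup (F : fieldType) (A : naAlgType F) (S : set A) :
  is_subgroup (aut_stab S).
Proof.
split=> [|g h gS hS|g gS]; rewrite /aut_stab /=.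
- by rewrite image_id.
- by rewrite -[in RHS]hS -[in RHS]gS -image_comp.
- apply/seteqP; split=> [_ [x + <-]|x Sx].
    by rewrite -{1}gS => -[y Sy <-]; have /= -> := autK g y.
  by exists (g x); [rewrite -gS; exists x|apply: autK].
Qed.

Section Polygon.
Variables (F : fieldType) (alpha beta : F).
Hypothesis distinct : uniq [:: 1; 0; alpha; beta].
Hypothesis char2 : 2%N \notin [pchar F].
Variables (n : nat) (A : naAlgType F) (a : A) (z : 'Z_n -> A).
Hypotheses (n_ge3 : (3 <= n)%N) (n_odd : odd n).

Local Notation M := (monster alpha beta).
Local Notation tau := (@miyamoto F A alpha beta).
Local Notation sig := (sigma alpha a).

(** The axes of an axet X_1(1 + n) in its completion, with the vertices numbered
    in such a way that two given generators [b] and [c] are [z 0] and [z 1]. *)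
Definition polygon_axes : Prop :=
  [/\ primitive_axis M a, (forall i, primitive_axis M (z i)), injective z &
   [/\ forall i j, tau (z i) (z j) = z (i *+ 2 - j), forall i, tau (z i) a = a,
       tau a = 1%g & gen_set (a |` range z) = setT]].

Hypothesis axes : polygon_axes.

Let aP : primitive_axis M a. Proof. by case: axes. Qed.
Let zP i : primitive_axis M (z i). Proof. by case: axes. Qed.
Let aL : axis M a. Proof. by case: aP. Qed.
Let zL i : axis M (z i). Proof. by case: (zP i). Qed.
Let z_inj : injective z. Proof. by case: axes. Qed.
Let tau_z i j : tau (z i) (z j) = z (i *+ 2 - j).
Proof. by case: axes => _ _ _ []. Qed.
Let tau_a i : tau (z i) a = a. Proof. by case: axes => _ _ _ []. Qed.
Let tau_a1 : tau a = 1%g. Proof. by case: axes => _ _ _ []. Qed.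
Let axes_gen : gen_set (a |` range z) = setT.
Proof. by case: axes => _ _ _ []. Qed.

Let n_gt1 : (1 < n)%N. Proof. exact: ltnW. Qed.
Let graded := monster_graded distinct.
Let tau2 i : (tau (z i) * tau (z i) = 1)%g := sign_aut2 (zL i) graded.

Lemma polygon_reflection_inj i j : tau (z i) = tau (z j) -> i = j.
Proof.
move=> E; apply: (Zp_double_inj n_gt1 n_odd); apply: (addIr (- i)); apply: z_inj.
by rewrite -!tau_z E.
Qed.

Lemma polygon_tau_neq1 i : tau (z i) <> 1%g.
Proof.
move=> E; have := tau_z i (i + 1); rewrite E => /z_inj/esym/eqP.
rewrite subr_eq -mulr2n => /eqP/(Zp_double_inj n_gt1 n_odd)/eqP.
by rewrite -subr_eq0 opprD addNKr oppr_eq0 oner_eq0.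
Qed.

Let a_beta v : eigen a beta v -> v = 0.
Proof. by apply: (miyamoto_fixed_beta distinct char2 aL); rewrite tau_a1. Qed.

Let aJ : axis (jordan alpha) a := monster_jordan distinct a_beta aL.
Let sig_graded := jordan_graded distinct.
Let sig_sign : acts_by_sign [:: alpha] [:: 1; 0] a sig := sign_autP aJ sig_graded.
Let sig2 : (sig * sig = 1)%g := sign_aut2 aJ sig_graded.

Let sigK : involutive sig. Proof. by move=> v; rewrite -autMg sig2. Qed.

Let sig_a : sig a = a.
Proof. by apply: (sig_sign.2 1); [rewrite mem_head|apply: axis_eigen1 aL]. Qed.

Let sig_tau i v : sig (tau (z i) v) = tau (z i) (sig v).
Proof.
have := sign_autJ (tau (z i)) aJ sig_graded; rewrite tau_a => E.
by rewrite -!autMg {1}/sigma {1}E !mulgA mulgV mul1g.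
Qed.

Let tau_sig i : tau (sig (z i)) = tau (z i).
Proof.
rewrite /miyamoto (sign_autJ sig (zL i) graded); apply: autE => v.
by rewrite !autMg sig_tau autVK.
Qed.

Let tau_sz i j : tau (z i) (sig (z j)) = sig (z (i *+ 2 - j)).
Proof. by rewrite -sig_tau tau_z. Qed.

Let sig_zP i : primitive_axis M (sig (z i)).
Proof. exact/aut_primitive_axis/zP. Qed.

(** The reflections fix [a], so they commute with [sigma_a], and [z i] and its image
    have the same Miyamoto involution. If the image is a vertex, it is therefore
    [z i] itself; then [sigma_a] fixes all vertices, by transitivity. *)
Lemma polygon_sigma_disjoint i j : sig <> 1%g -> sig (z i) <> z j.
Proof.
move=> sig1 E; apply: sig1; apply: (aut_eq_gen axes_gen) => _ [->|[k _ <-]].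
  exact: sig_a.
have ij : i = j by apply: polygon_reflection_inj; rewrite -tau_sig E.
apply: (@Zp_reflections_transitive _ n_gt1 n_odd (fun k => sig (z k) = z k) i).
- by move=> m mE; rewrite -tau_z sig_tau mE.
- by move=> m mE; rewrite -tau_z sig_tau mE.
- by rewrite {2}ij.
Qed.

Lemma polygon_neq_fixed i : a <> z i.
Proof. by move=> E; apply: (@polygon_tau_neq1 i); rewrite -E. Qed.

Let gen_reflect (Y : set A) i v : gen_set Y (z i) \/ gen_set Y (sig (z i)) ->
  gen_set Y v -> gen_set Y (tau (z i) v).
Proof.
case=> Yi Yv; first exact: (sign_aut_stable (zL i) graded (gen_set_subalgebra Y) Yi).
rewrite -tau_sig; have [sL _] := sig_zP i.
exact: (sign_aut_stable sL graded (gen_set_subalgebra Y) Yi).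
Qed.

Lemma polygon_gen i : gen_set [set z 0; z 1] (z i).
Proof.
have Y0 := @gen_set_fst _ _ (z 0) (z 1); have Y1 := @gen_set_snd _ _ (z 0) (z 1).
apply: (@Zp_reflections_transitive _ n_gt1 n_odd
  (fun k => gen_set [set z 0; z 1] (z k)) 0) => // k Yk.
  by rewrite -tau_z; apply: gen_reflect => //; left.
by rewrite -tau_z; apply: gen_reflect => //; left.
Qed.

Lemma polygon_gen' i : gen_set [set sig (z 0); z 1] (z i) /\
  gen_set [set sig (z 0); z 1] (sig (z i)).
Proof.
have Y0 := @gen_set_fst _ _ (sig (z 0)) (z 1).
have Y1 := @gen_set_snd _ _ (sig (z 0)) (z 1).
split.
  apply: (@Zp_reflections_transitive _ n_gt1 n_odd
    (fun k => gen_set [set sig (z 0); z 1] (z k)) 1) => // k Yk.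
    by rewrite -tau_z; apply: gen_reflect => //; right.
  by rewrite -tau_z; apply: gen_reflect => //; left.
apply: (@Zp_reflections_transitive _ n_gt1 n_odd
  (fun k => gen_set [set sig (z 0); z 1] (sig (z k))) 0) => // k Yk.
  by rewrite -tau_sz; apply: gen_reflect => //; right.
by rewrite -tau_sz; apply: gen_reflect => //; left.
Qed.

Let swap : exists i, tau (z i) (z 0) = z 1 /\ tau (z i) (z 1) = z 0.
Proof.
have [h h2] := Zp_halve n_gt1 n_odd; exists h.
by rewrite !tau_z h2 subr0 subrr.
Qed.

Let z01 : z 0 <> z 1.
Proof. by move=> /z_inj/esym/eqP; rewrite oner_eq0. Qed.

(** As [n] is odd, some reflection swaps [z 0] and [z 1]. *)
Lemma polygon_symmetric :
  symmetric_alg alpha beta (gen1 (z 0) (z 1)) (gen2 (z 0) (z 1)).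
Proof.
have [i [i0 i1]] := swap.
exact: (symmetric_pair distinct (zP 0) (zP 1) (tau2 i) i0 i1 z01).
Qed.

Lemma polygon_symmetric' : sig <> 1%g ->
  symmetric_alg alpha beta (gen1 (sig (z 0)) (z 1)) (gen2 (sig (z 0)) (z 1)).
Proof.
move=> sig1; have [i [i0 i1]] := swap.
apply: (@symmetric_pair _ _ _ distinct _ _ _ (sig * tau (z i))%g) => //.
- apply: autE => v; rewrite !autMg sig_tau sigK.
  by rewrite -autMg tau2.
- by rewrite autMg sigK.
- by rewrite autMg -sig_tau i1.
- exact: polygon_sigma_disjoint.
Qed.

(** If [A_alpha(a) = 0], then the component of an axis [z i] in [A_1(a) = F a] is [k a]
    with [k] idempotent; and [k = 1] would mean that [z i] absorbs [a]. *)
Lemma polygon_orthogonal i : sig = 1%g -> a ** z i = 0.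
Proof.
move=> sig1; have [_ aa _ _] := aL; have [_ zz _ _] := zL i.
have a_alpha v : eigen a alpha v -> v = 0.
  move=> av; apply: (eq_opp0 char2).
  by rewrite -(sig_sign.1 alpha v) ?mem_head // sig1.
have [k [q [aq zE]]] : exists k q, eigen a 0 q /\ z i = k *: a + q.
  have [_ _ dec _] := aJ; have [_ prim] := aP.
  have : eigen_sum a ([:: 1; 0] ++ [:: alpha]) (z i) by rewrite dec.
  move=> /eigen_sum_cat[u [w [/(@eigen_sum_cat _ _ _ [:: 1])[p [q]]]]].
  move=> [/eigen_sum1 + /eigen_sum1 aq uE] /eigen_sum1/a_alpha-> ->.
  by rewrite prim => -[k _ kp]; exists k, q; rewrite addr0 uE kp.
have aq0 : a ** q = 0 by rewrite aq scale0r.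
have az : a ** z i = k *: a by rewrite zE amulDr amulZr aa aq0 addr0.
have zzE : z i ** z i = (k * k) *: a + q ** q.
  rewrite {1}zE amulDl amulZl az scalerA zE amulDr amulZr [q ** a]amulC aq0.
  by rewrite scaler0 add0r.
have dom0 : {subset [:: 0] <= law_dom M}.
  by move=> l; rewrite !inE => ->; rewrite orbT.
have q0 := eigen_sum_single aq.
have qq0 := axis_fusion aL (fusion00 distinct) isT dom0 dom0 q0 q0.
have [/eqP + _] : (k * (k - 1)) *: a = 0 /\ q ** q - q = 0.
  apply: (@eigen_direct _ _ a [:: 1] [:: 0]).
  - by rewrite /= inE oner_eq0.
  - apply: (subspaceZ (eigen_sum_subspace a _)).
    exact: eigen_sum_single (axis_eigen1 aL).
  - exact: subspaceB (eigen_sum_subspace a _) _ _ qq0 q0.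
  rewrite mulrBr mulr1 scalerBl addrACA -opprD -zzE zz.
  by rewrite zE subrr.
have [a0 _ _ _] := aL; rewrite scaler_eq0 (negPf a0) orbF mulf_eq0 subr_eq0.
case/orP=> /eqP kE; first by rewrite az kE scale0r.
case: (@polygon_neq_fixed i); apply: (primitive_absorb aL (zP i)).
by rewrite az kE scale1r.
Qed.

Lemma polygon_2B : sig = 1%g -> (gen_alg [set a; z 0] : naAlgType F) ~= alg2B F.
Proof.
move=> sig1; have [a0 aa _ _] := aL; have [z0 zz _ _] := zL 0.
apply: gen2_2B => //; last exact: polygon_orthogonal.
exact/eqP/polygon_neq_fixed.
Qed.

Lemma polygon_direct_sum : sig = 1%g ->
  A ~= (alg1A F * gen_alg [set z 0; z 1])%type.
Proof.
move=> sig1; apply: alg_isomorphic_sym.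
have [a0 aa _ _] := aL; have dom0 : {subset [:: 0] <= law_dom M}.
  by move=> l; rewrite !inE => ->; rewrite orbT.
have orth (u : gen_alg [set z 0; z 1]) : a ** gen_val u = 0.
  have : eigen a 0 (gen_val u); last by rewrite /eigen /= scale0r.
  apply: (gen_set_min _ _ (gen_valE u)) => [|_ [->|->]]; last 2 first.
  - by rewrite /eigen /= polygon_orthogonal // scale0r.
  - by rewrite /eigen /= polygon_orthogonal // scale0r.
  have [E0 EL] := eigen_subspace a 0; split=> // x y ax ay.
  apply: eigen_sum1; apply: (axis_fusion aL (fusion00 distinct) isT dom0 dom0).
    exact: eigen_sum_single.
  exact: eigen_sum_single.
pose f (d : alg1A F * gen_alg [set z 0; z 1]) : A := (d.1 : F) *: a + gen_val d.2.
have v_hom := @gen_val_hom F A [set z 0; z 1].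
have f_hom : alg_hom f.
  split=> [k [x u] [y v]|[x u] [y v]]; rewrite /f /=.
    by rewrite scalerDl scalerDr scalerA addrACA.
  rewrite amulDl !amulDr !amulZl !amulZr aa orth [gen_val u ** a]amulC orth.
  by rewrite !scaler0 addr0 add0r scalerA.
exists f; apply: (alg_isoI f_hom).
  move=> [x u] [y v] /eqP; rewrite -subr_eq0 -(homB f_hom) => /eqP E.
  have xy : x = y :> F.
    have := congr1 (amul a) E; rewrite /f amulDr amulZr aa orth addr0 amulC amul0r.
    by move=> /eqP; rewrite scaler_eq0 (negPf a0) orbF subr_eq0 => /eqP.
  move: E; rewrite /f /= xy subrr scale0r add0r => /eqP.
  by rewrite subr_eq0 => /eqP/gen_val_inj->.
move=> v; have [d _ fd] : range f v; last by exists d.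
have : gen_set (a |` range z) v by rewrite axes_gen.
apply: gen_set_min => [|_ [->|[i _ <-]]].
- split=> [|k _ _ [x _ <-] [y _ <-]|_ _ [x _ <-] [y _ <-]].
  + by exists 0; rewrite ?hom0.
  + by exists (k *: x + y); rewrite // (homD f_hom) (homZ f_hom).
  + by exists (x ** y); rewrite // (homM f_hom).
- by exists (1, 0) => //; rewrite /f /= scale1r addr0.
have [u uE] := gen_valK (polygon_gen i).
by exists (0, u) => //; rewrite /f /= scale0r add0r.
Qed.

(** In [<<a, b>>] the Miyamoto involutions of both axes are trivial, as each axis
    fixes the other; so there the axes satisfy the Jordan fusion law. *)
Lemma polygon_J2 : J2 (gen_alg [set a; z 0] : naAlgType F) alpha.
Proof.
exists (gen1 a (z 0)), (gen2 a (z 0)); split; last exact: gen12_generate.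
all: have [[aM aprim] [zM zprim] _] := two_gen_pair distinct aP (zP 0).
  split=> //; apply: (monster_jordan distinct) aM => v /eigen_restrict av.
  exact/gen_val_inj/a_beta.
split=> //; apply: (monster_jordan distinct) zM => v /eigen_restrict zv.
apply: gen_val_inj; apply: (miyamoto_fixed_beta distinct char2 (zL 0)) zv.
apply: (aut_fix_gen _ (gen_valE v)) => _ [->|->]; first exact: tau_a.
by rewrite tau_z mulr2n subr0 addr0.
Qed.

(** The product of two nonzero idempotents of 2B is 0 or one of the two; the last
    two cases would make one axis absorb the other. *)
Lemma polygon_not_2B : sig <> 1%g ->
  ~ ((gen_alg [set a; z 0] : naAlgType F) ~= alg2B F).
Proof.
move=> sig1 [h [h_hom h_bij]]; have h_inj := bij_inj h_bij.
have [[aN0 aa _ _] _] := aP; have [[zN0 zz _ _] _] := zP 0.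
pose x := gen1 a (z 0); pose y := gen2 a (z 0).
have idem (k : F) : k * k = k -> k = 0 \/ k = 1.
  move=> /eqP; rewrite -subr_eq0 -{3}[k]mulr1 -mulrBr mulf_eq0 subr_eq0.
  by case/orP=> /eqP ->; [left|right].
have h_idem (v : gen_alg [set a; z 0]) : v ** v = v -> v != 0 ->
    (((h v).1 : F) = 0 \/ ((h v).1 : F) = 1) /\
    (((h v).2 : F) = 0 \/ ((h v).2 : F) = 1) /\
    ~ ((((h v).1 : F) = 0) /\ (((h v).2 : F) = 0)).
  move=> vv vN0; have := homM h_hom v v; rewrite vv => E; split; [|split].
  - by apply: idem; move/(congr1 fst): E.
  - by apply: idem; move/(congr1 snd): E.
  - case=> E1 E2; case/eqP: vN0; apply: h_inj; rewrite (hom0 h_hom).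
    by case: (h v) E1 E2 => p q /= -> ->.
have xx : x ** x = x by apply: gen_val_inj.
have yy : y ** y = y by apply: gen_val_inj.
have xN0 : x != 0 by apply: contraNneq aN0 => /(congr1 (@gen_val _ _ _))/=->.
have yN0 : y != 0 by apply: contraNneq zN0 => /(congr1 (@gen_val _ _ _))/=->.
have hxy := homM h_hom x y.
have az : [\/ x ** y = 0, x ** y = x | x ** y = y].
  have [] := h_idem x xx xN0; have [] := h_idem y yy yN0; move: hxy.
  case hx: (h x) => [p1 p2]; case hy: (h y) => [q1 q2] /= hxy.
  have {}hxy : h (x ** y) = ((p1 : F) * (q1 : F), (p2 : F) * (q2 : F)) by [].
  move=> q1E [q2E qN] p1E [p2E pN].
  case: q1E => ?; case: q2E => ?; case: p1E => ?; case: p2E => ?; subst;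
    rewrite ?(mul0r, mulr0, mul1r) in hxy;
    first [by case: pN | by case: qN
          |by apply: Or31; apply: h_inj; rewrite hxy (hom0 h_hom)
          |by apply: Or32; apply: h_inj; rewrite hxy hx
          |by apply: Or33; apply: h_inj; rewrite hxy hy].
case: az => /(congr1 (@gen_val _ _ _))/= az.
- apply: (@polygon_sigma_disjoint 0 0 sig1); apply: (sig_sign.2 0).
    by rewrite !inE eqxx orbT.
  by rewrite /eigen /= az scale0r.
- exact: (@polygon_neq_fixed 0 (primitive_absorb aL (zP 0) az)).
apply: (@polygon_neq_fixed 0); apply/esym; apply: (primitive_absorb (zL 0) aP).
by rewrite amulC.
Qed.

Let E : set A := a |` (range z `|` (sig @` range z)).
Let t (x : A) : aut A := if x == a then sig else tau x.
Let half_turn (k : 'Z_(n.*2)) : A :=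
  if odd k then sig (z (Zp_residue k)) else z (Zp_residue k).

Let Ea : E a. Proof. by left. Qed.
Let Ez i : E (z i). Proof. by right; left; exists i. Qed.
Let Esz i : E (sig (z i)). Proof. by right; right; exists (z i) => //; exists i. Qed.

Let sz_neq i : a <> sig (z i).
Proof. by rewrite -{1}sig_a => /aut_inj; apply: polygon_neq_fixed. Qed.

Let t_a : t a = sig. Proof. by rewrite /t eqxx. Qed.

Let t_z i : t (z i) = tau (z i).
Proof. by rewrite /t; case: eqP => // /esym/polygon_neq_fixed. Qed.

Let t_sz i : t (sig (z i)) = tau (z i).
Proof. by rewrite /t; case: eqP => [/esym/sz_neq|_] //; apply: tau_sig. Qed.

Let E_t x y : E x -> E y -> E (t x y).
Proof.
have E_tau i v : E v -> E (tau (z i) v).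
  case=> [->|[[j _ <-]|[_ [j _ <-] <-]]]; first by rewrite tau_a.
    by rewrite tau_z.
  by rewrite tau_sz.
case=> [->|[[i _ <-]|[_ [i _ <-] <-]]].
- rewrite t_a => -[->|[[j _ <-]|[_ [j _ <-] <-]]]; first by rewrite sig_a.
    exact: Esz.
  by rewrite sigK.
- by rewrite t_z; apply: E_tau.
- by rewrite t_sz; apply: E_tau.
Qed.

Let t2 x : E x -> (t x * t x = 1)%g.
Proof.
by case=> [->|[[i _ <-]|[_ [i _ <-] <-]]]; rewrite ?t_a ?t_z ?t_sz.
Qed.

(** Among the axes of [E], only [a] has a trivial Miyamoto involution in [A]. *)
Let E_stab_a (g : aut A) : aut_stab E g -> g a = a.
Proof.
move=> gE; have : E (g a) by rewrite -gE; exists a.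
have tau_ga : tau (g a) = 1%g.
  by rewrite /miyamoto (sign_autJ g aL graded) -/(tau a) tau_a1 mulg1 mulVg.
case=> [//|[[i _ E']|[_ [i _ <-] E']]]; case: (@polygon_tau_neq1 i).
  by rewrite E'.
by rewrite -tau_sig E'.
Qed.

Lemma polygon_double_axetP : is_axet (@aut_act F A) (aut_stab E) E t.
Proof.
split=> //.
- exact: aut_stab_subgroup.
- by move=> x g Ex gE; rewrite -gE; exists x.
- move=> x Ex; apply/seteqP; split=> [_ [y Ey <-]|y Ey]; first exact: E_t.
  by exists (t x y); [apply: E_t|rewrite -autMg t2].
- move=> x [->|[[i _ <-]|[_ [i _ <-] <-]]]; rewrite /aut_act.
  + by rewrite t_a.
  + by rewrite t_z tau_z mulr2n addrK.
  + by rewrite t_sz tau_sz mulr2n addrK.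
move=> x g Ex gE; have ga := E_stab_a gE; rewrite /aut_act.
have [->|xa] := eqVneq x a.
  by rewrite ga t_a {1}/sigma -{1}ga (sign_autJ g aJ sig_graded).
rewrite /t (negPf xa) -{1}ga (inj_eq (@aut_inj _ _ g)) (negPf xa).
have xL : axis M x.
  case: Ex xa => [->|[[i _ <-]|[_ [i _ <-] <-]]] // _.
  by have [] := sig_zP i.
exact: sign_autJ xL graded.
Qed.

Lemma polygon_double_tau x : range z x -> t x = tau x /\ t (sig x) = tau x.
Proof. by case=> i _ <-; rewrite t_z t_sz. Qed.

(** The axis of the polygon with residue [i] gets the even representative of [i]
    modulo [2n], and its image under [sigma_a] the odd one. As [n] is odd,
    adding [n] changes the parity and keeps the residue. *)
Lemma polygon_double_axet : sig <> 1%g ->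
  axet_isomorphic (Axet polygon_double_axetP) (axX2 n).
Proof.
move=> sig1; apply: (@axet_isomorphic_inv (Axet polygon_double_axetP) (axX2 n)
  (oapp half_turn a) None) => //=.
  split.
  - case=> [k|] _ /=; last exact: Ea.
    by rewrite /half_turn; case: ifP.
  - have ha k : half_turn k <> a.
      rewrite /half_turn; case: ifP => _ /esym; [exact: sz_neq|exact: polygon_neq_fixed].
    case=> [k|] [l|] _ _ //=; last 2 first.
    + by move/ha.
    + by move/esym/ha.
    rewrite /half_turn => kl; congr Some; move: kl.
    case k_odd: (odd k); case l_odd: (odd l).
    + by move=> /aut_inj/z_inj; apply: Zp_crt_inj; rewrite // k_odd.
    + by move/(polygon_sigma_disjoint sig1).
    + by move/esym/(polygon_sigma_disjoint sig1).
    + by move=> /z_inj; apply: Zp_crt_inj; rewrite // k_odd.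
  move=> v [->|[[i _ <-]|[_ [i _ <-] <-]]]; first by exists None.
    have [k k_even ki] := Zp_crt_surj n_gt1 n_odd false i.
    by exists (Some k); rewrite //= /half_turn k_even ki.
  have [k k_odd ki] := Zp_crt_surj n_gt1 n_odd true i.
  by exists (Some k); rewrite //= /half_turn k_odd ki.
have t_half k : t (half_turn k) = tau (z (Zp_residue k)).
  by rewrite /half_turn; case: ifP.
case=> [i|] [k|] _ _ //=; rewrite /aut_act ?t_half ?t_a ?tau_a ?sig_a //.
  rewrite (_ : dih_act k _ = i *+ 2 - k); last first.
    by rewrite /dih_act /= expr1 mulN1r addrC.
  rewrite /half_turn Zp_parity_refl // Zp_residue_refl //.
  by case: ifP; rewrite ?tau_z ?tau_sz.
rewrite (_ : dih_act k _ = k + n%:R); last by rewrite /dih_act /= mul1r.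
rewrite /half_turn Zp_parity_half // Zp_residue_half //.
by case: (odd k); rewrite /= ?sigK.
Qed.

(** The axes [sigma_a (z 0)] and [z 0] have the same Miyamoto involution, so the
    group is generated by the reflections in two adjacent vertices, and the
    orbits of [sigma_a (z 0)] and [z 1] are the two polygons. *)
Lemma polygon_axet2 (b' := gen1 (sig (z 0)) (z 1)) (c := gen2 (sig (z 0)) (z 1)) :
  [set gen_val v | v in axet2 alpha beta b' c] = range z `|` (sig @` range z).
Proof.
set O := [set gen_val v | v in _]; pose D := range z `|` (sig @` range z).
have b'L : axis M (gen_val b') by have [] := sig_zP 0.
have cL : axis M (gen_val c) := zL 1.
have tau_b' v : gen_val (miyamoto alpha beta b' v) = tau (z 0) (gen_val v).
  by rewrite (miyamoto_restrict distinct) // tau_sig.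
have tau_c v : gen_val (miyamoto alpha beta c v) = tau (z 1) (gen_val v).
  by rewrite (miyamoto_restrict distinct).
set G := gen_group [set miyamoto alpha beta b'; miyamoto alpha beta c].
have G_sub : is_subgroup G.
  split=> [|g h Gg Gh|g Gg] K [K_sub KS]; have [K1 KM KV] := K_sub => //.
    by apply: KM; [apply: Gg|apply: Gh].
  by apply: KV; apply: Gg.
have [G1 GM _] := G_sub.
have Gb' : G (miyamoto alpha beta b') by move=> K [_]; apply; left.
have Gc : G (miyamoto alpha beta c) by move=> K [_]; apply; right.
have D_tau i v : D v <-> D (tau (z i) v).
  have D_imp w : D w -> D (tau (z i) w).
    case=> [[j _ <-]|[_ [j _ <-] <-]].
      by left; rewrite tau_z; exists (i *+ 2 - j).
    by right; rewrite tau_sz; exists (z (i *+ 2 - j)) => //; exists (i *+ 2 - j).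
  split; first exact: D_imp.
  by move/D_imp; rewrite -autMg tau2.
apply/seteqP; split=> [_ [v [g Gg vE] <-]|].
  have gD : forall v, D (gen_val v) <-> D (gen_val (g v)).
    apply: (Gg [set g | forall v, D (gen_val v) <-> D (gen_val (g v))]).
    split=> [|h [->|->] v']; last 2 first.
    - by rewrite tau_b'.
    - by rewrite tau_c.
    split=> [//|h k hD kD v'|h hD v'].
      by rewrite autMg -kD.
    by rewrite [X in _ <-> X]hD autVK.
  case: vE => ->; apply: (gD _).1; last by left; exists 1.
  by right; exists (z 0) => //; exists 0.
have O_mul h v : G h -> O (gen_val v) -> O (gen_val (h v)).
  move=> Gh [w [g Gg wE] /gen_val_inj<-]; exists (h w) => //.
  by exists (g * h)%g; [apply: GM|case: wE => ->; [left|right]].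
have O_tau0 v : O v -> O (tau (z 0) v).
  by move=> Ov; case: (Ov) => w _ wv; rewrite -wv -tau_b'; apply: O_mul; rewrite ?wv.
have O_tau1 v : O v -> O (tau (z 1) v).
  by move=> Ov; case: (Ov) => w _ wv; rewrite -wv -tau_c; apply: O_mul; rewrite ?wv.
have Ob' : O (sig (z 0)) by exists b' => //; exists 1%g; [|left].
have Oc : O (z 1) by exists c => //; exists 1%g; [|right].
move=> _ [[i _ <-]|[_ [i _ <-] <-]].
  apply: (@Zp_reflections_transitive _ n_gt1 n_odd (fun k => O (z k)) 1) => // k.
    by rewrite -tau_z; apply: O_tau0.
  by rewrite -tau_z; apply: O_tau1.
apply: (@Zp_reflections_transitive _ n_gt1 n_odd (fun k => O (sig (z k))) 0) => // k.
  by rewrite -tau_sz; apply: O_tau0.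
by rewrite -tau_sz; apply: O_tau1.
Qed.

(** As [<<b', c>>] contains all vertices of both polygons, it is [A] as soon
    as [a] lies in [<<b, b'>>]. *)
Lemma polygon_trichotomy : sig <> 1%g ->
  [\/ gen_set [set sig (z 0); z 1] = setT,
      [/\ alpha = 2%:R^-1,
          (gen_alg [set a; z 0] : naAlgType F) ~= spin (-2%:R : F) &
          (gen_alg [set z 0; sig (z 0)] : naAlgType F) ~= spin2o F] |
      [/\ alpha = 2%:R^-1,
          exists2 f : spin (0 : F) -> gen_alg [set a; z 0], alg_iso f &
            exists x y, [/\ spin_opposite x y, f x = z 0 :> A &
                            f y = sig (z 0) :> A] &
          (gen_alg [set z 0; sig (z 0)] : naAlgType F) ~= alg2B F]].
Proof.
move=> sig1; have az : eigen_sum a [:: 1; 0; alpha] (z 0).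
  by apply: (miyamoto_fixed distinct char2 aL); rewrite tau_a1.
have za : eigen_sum (z 0) [:: 1; 0; alpha] a.
  exact: (miyamoto_fixed distinct char2 (zL 0) (tau_a 0)).
have [a_in||] := jordan_pair_trichotomy char2 distinct aP (zP 0) az za sig_sign
  (@polygon_sigma_disjoint 0 0 sig1); [|exact: Or32|exact: Or33].
apply: Or31; apply/seteqP; split=> // v _.
have : gen_set (a |` range z) v by rewrite axes_gen.
apply: gen_set_sub => _ [->|[i _ <-]]; last by have [] := polygon_gen' i.
by apply: gen_set_sub a_in => _ [->|->]; have [] := polygon_gen' 0.
Qed.

End Polygon.

(** * Generators of the axet X_1(1 + n) *)

Section X1Generators.
Variable n : nat.

Let act (x y : option 'Z_n) := fixed_act y (axet_tau_with 1%g x).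

Let act_closed (C : set (option 'Z_n)) := forall x y, C x -> C y -> C (act x y).

(** The fixed axis and the vertices [i + m * d] form a subaxet, which is the whole
    axet; that [i + 1] is among these vertices means that [d] is a unit. *)
Lemma X1_generators (x y : option 'Z_n) :
    (forall C, act_closed C -> C None -> C x -> C y -> forall o, C o) ->
  exists i d e, [/\ x = Some i, y = Some (i + d) & d * e = 1].
Proof.
move=> gen.
have pair_closed o : act_closed [set None; o].
  have act_o : act o o = o.
    case: o => [j|] //; congr Some.
    by rewrite /dih_act /= expr1 mulN1r mulr2n addKr.
  have act_None o' : act o' None = None by [].
  have act1 o' : act None o' = o'.
    by case: o' => // j; congr Some; apply: etrans (addr0 _) (mul1r _).
  by move=> u v [->|->] [->|->]; rewrite ?act_None ?act1 ?act_o;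
    do ?[by left|by right].
(* There are at least two vertices, 0 and 1. *)
have no_pair (o : option 'Z_n) : ~ (forall o', [set None; o] o').
  move=> full; have := full (Some 0); have := full (Some 1).
  by case=> // <- [] // [] /eqP; rewrite eq_sym oner_eq0.
case: x y gen => [i|] [j|] gen; last 3 first.
- by case: (no_pair (Some i)); apply: gen => //; [left|right|left].
- by case: (no_pair (Some j)); apply: gen => //; [left|left|right].
- by case: (no_pair None); apply: gen => //; left.
pose C (o : option 'Z_n) :=
  if o is Some k then exists m, k = i + m * (j - i) else True.
have C_closed : act_closed C.
  case=> [k|] [l|] //; last first.
    by move=> _ [m ->]; exists m; rewrite /dih_act /= mul1r addr0.
  move=> [m ->] [p ->]; exists (m *+ 2 - p).
  by rewrite /dih_act /=; ring.
have [|||m mE] := gen C C_closed _ _ _ (Some (i + 1)).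
- by [].
- by exists 0; rewrite mul0r addr0.
- by exists 1; rewrite mul1r addrC subrK.
exists i, (j - i), m; split=> //; first by rewrite addrC subrK.
by rewrite mulrC; apply/esym/(addrI i).
Qed.

(** The vertices are renumbered by [k |-> i + k * d]. *)
Lemma X1_vertices (X : axet) (a b c : axT X) (iota : axT (axX1 n) -> axT X) :
    axX X b -> axX X c -> axet_gen [set a; b; c] = axX X ->
    axet_iso_on (axX (axX1 n)) iota -> iota None = a ->
  exists w : 'Z_n -> axT X,
    [/\ w 0 = b, w 1 = c, injective w, range w = axX X `\ a &
     [/\ forall i j, axact (w j) (axtau (w i)) = w (i *+ 2 - j),
         forall i, axact a (axtau (w i)) = a &
         forall i, axact (w i) (axtau a) = w i]].
Proof.
move=> Xb Xc Xgen [[iota_fun iota_morph] [_ iota_inj iota_surj]] iota_a.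
have {}iota_inj : injective iota by move=> x y; apply: iota_inj; rewrite inE.
have [x _ xb] := iota_surj _ Xb; have [y _ yc] := iota_surj _ Xc.
have [|i [d [e [xE yE de]]]] := @X1_generators x y.
  move=> C C_closed C0 Cx Cy o.
  have : axet_gen [set a; b; c] (iota o) by rewrite Xgen; apply: iota_fun.
  move=> /(_ (iota @` C)) [].
    split; last by move=> _ [[->|->]|->]; [exists None|exists x|exists y].
    split; first by move=> _ [u _ <-]; apply: iota_fun.
    move=> _ _ [u Cu <-] [v Cv <-]; rewrite -iota_morph //.
    by exists (fixed_act u (axet_tau_with 1%g v)) => //; apply: C_closed.
  by move=> u Cu /iota_inj<-.
have w_inj : injective (fun k : 'Z_n => Some (i + k * d)).
  move=> k l /Some_inj/addrI kl; rewrite -[k]mulr1 -[l]mulr1 -de !mulrA.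
  by rewrite kl.
exists (fun k => iota (Some (i + k * d))); split.
- by rewrite mul0r addr0 -xE.
- by rewrite mul1r -yE.
- by move=> k l /iota_inj/w_inj.
- apply/seteqP; split=> [_ [k _ <-]|v [/iota_surj[[k|] _ <-] va]].
  + split; first exact: iota_fun.
    by rewrite /= -iota_a => /iota_inj.
  + exists ((k - i) * e) => //; congr (iota (Some _)).
    by rewrite -mulrA [e * d]mulrC de mulr1 addrC subrK.
  + by case: va; rewrite iota_a.
split=> [k l|k|k].
- rewrite -iota_morph //; congr (iota (Some _)); rewrite /dih_act /=; ring.
- by rewrite -iota_a -iota_morph.
- rewrite -iota_a -iota_morph //; congr (iota (Some _)).
  by rewrite /dih_act /= mul1r addr0.
Qed.

End X1Generators.

(** * The theorem *)

Theorem proposition6p1 (F : fieldType) (char2 : 2%N \notin [pchar F])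
  (alpha beta : F) (distinct : uniq [:: 1; 0; alpha; beta])
  (n : nat) (n_ge3 : (3 <= n)%N) (n_odd : odd n)
  (X : axet) (a b c : axT X)
  (Xa : axX X a) (Xb : axX X b) (Xc : axX X c)
  (Xgen : axet_gen [set a; b; c] = axX X)
  (iota : axT (axX1 n) -> axT X)
  (iota_iso : axet_iso_on (axX (axX1 n)) iota) (iota_a : iota None = a)
  (Theta : axet_shape alpha beta X) (A : axialAlg alpha beta) (psi : axT X -> A)
  (A_completion : completion Theta psi) (A_identified : identified Theta psi) :
  let Y : set (axT X) := axet_gen [set a; b] in
  let A_Y : naAlgType F := gen_alg (psi @` Y) in
  let tau := @miyamoto F A alpha beta in
  let sigma_a : aut A := sigma alpha (psi a) in
  let Z : set A := psi @` (axX X `\ a) in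
  let Z' : set A := sigma_a @` Z in
  let b' : A := sigma_a (psi b) in
  Y = [set a; b] /\
  (sigma_a = 1%g ->
    [/\ A_Y ~= alg2B F,
        A ~= (alg1A F * gen_alg [set psi b; psi c])%type &
        symmetric_alg alpha beta (gen1 (psi b) (psi c)) (gen2 (psi b) (psi c))])
  /\
  (sigma_a <> 1%g ->
    let E : set A := psi a |` (Z `|` Z') in
    [/\ J2 A_Y alpha /\ ~ (A_Y ~= alg2B F),
        exists (t : A -> aut A)
               (tP : is_axet (@aut_act F A) (aut_stab E) E t),
          [/\ t (psi a) = sigma_a,
              forall z, Z z -> t z = tau z /\ t (sigma_a z) = tau z &
              axet_isomorphic (Axet tP) (axX2 n)],
        symmetric_alg alpha beta (gen1 b' (psi c)) (gen2 b' (psi c)),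
        [set gen_val v | v in axet2 alpha beta (gen1 b' (psi c))
                                              (gen2 b' (psi c))] = Z `|` Z' &
        [\/ gen_set [set b'; psi c] = setT,
            [/\ alpha = 2%:R^-1, A_Y ~= spin (-2%:R : F) &
                (gen_alg [set psi b; b'] : naAlgType F) ~= spin2o F] |
            [/\ alpha = 2%:R^-1,
                exists2 f : spin (0 : F) -> A_Y, alg_iso f &
                  exists x y, [/\ spin_opposite x y, f x = psi b :> A &
                                  f y = b' :> A] &
                (gen_alg [set psi b; b'] : naAlgType F) ~= alg2B F]]]).
Proof.
move=> Y A_Y tau sigma_a Z Z' b'.
have [w [w0 w1 w_inj w_range [w_refl wa aw]]] :=
  X1_vertices Xb Xc Xgen iota_iso iota_a.
have Xw i : axX X (w i).
  by have [] : (axX X `\ a) (w i) by rewrite -w_range; exists i.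
have Xcases x : axX X x -> x = a \/ exists i, x = w i.
  move=> Xx; have [->|xa] := pselect (x = a); first by left.
  by right; have [i _ <-] : range w x; [rewrite w_range|exists i].
have [[_ psi_morph] psi_X _] := A_completion.
have [psi_inj _] := A_identified.
have psi_tau x y : axX X x -> axX X y ->
    miyamoto alpha beta (psi x) (psi y) = psi (axact y (axtau x)).
  by move=> Xx Xy; rewrite psi_morph.
have psi_axis x : axX X x -> primitive_axis (monster alpha beta) (psi x).
  by move=> Xx; apply: ax_axis; rewrite -psi_X; exists x.
pose z i := psi (w i).
have ax_setE : @ax_set _ _ _ A = psi a |` range z.
  rewrite -psi_X; apply/seteqP; split=> [_ [x Xx <-]|_ [->|[i _ <-]]].
  - by have [->|[i ->]] := Xcases x Xx; [left|right; exists i].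
  - by exists a.
  - by exists (w i).
have axes : polygon_axes alpha beta (psi a) z.
  split=> [|i||]; [exact: psi_axis|exact: psi_axis| |].
    by move=> i j /psi_inj E; apply: w_inj; apply: E; rewrite inE.
  split=> [i j|i||].
  - by rewrite psi_tau // w_refl.
  - by rewrite psi_tau // wa.
  - apply: (aut_eq_gen (ax_gen A)) => v; rewrite ax_setE => -[->|[i _ <-]].
      by rewrite psi_tau // (axet_tau_fix (axP X)).
    by rewrite psi_tau // aw.
  - by rewrite -ax_setE ax_gen.
have YE : Y = [set a; b].
  apply/seteqP; split; last by move=> x Yx C [_]; apply.
  apply: smallest_sub => //; split=> [_ [->|->] //|_ _ [->|->] [->|->]].
  - by left; rewrite (axet_tau_fix (axP X)).
  - by left; rewrite -w0 wa.
  - by right; rewrite -w0 aw.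
  - by right; rewrite (axet_tau_fix (axP X)).
have psiYE : psi @` Y = [set psi a; z 0].
  by rewrite YE image_setU !image_set1 /z w0.
have ZE : Z = range z.
  by rewrite /Z -w_range image_comp.
have zb : psi b = z 0 by rewrite /z w0.
have zc : psi c = z 1 by rewrite /z w1.
split; first exact: YE.
rewrite /A_Y psiYE /b' /Z' ZE zb zc; split=> sig1.
  split; first exact: (polygon_2B distinct char2 n_ge3 n_odd axes sig1).
    exact: (polygon_direct_sum distinct char2 n_ge3 n_odd axes sig1).
  exact: (polygon_symmetric distinct n_ge3 n_odd axes).
split.
- split; first exact: (polygon_J2 distinct char2 axes).
  exact: (polygon_not_2B distinct char2 n_ge3 n_odd axes sig1).
- exists (fun x => if x == psi a then sigma_a else tau x).
  exists (polygon_double_axetP distinct char2 n_ge3 n_odd axes); split.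
  + by rewrite eqxx.
  + exact: (polygon_double_tau distinct char2 n_ge3 n_odd axes).
  + exact: (polygon_double_axet distinct char2 n_ge3 n_odd axes sig1).
- exact: (polygon_symmetric' distinct char2 n_ge3 n_odd axes sig1).
- exact: (polygon_axet2 distinct char2 n_ge3 n_odd axes).
exact: (polygon_trichotomy distinct char2 n_ge3 n_odd axes sig1).
Qed.
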